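(* The set of splitting Gibbs measures corresponding to the Hamiltonian $$H(\sigma)=-J_3\sum_{\langle y,x,z\rangle}\xi_1(\sigma(x),\sigma(y),\sigma(z))-J\sum_{\rangle y,z\langle}\xi_2(\sigma(y),\sigma(z))-J_1\sum_{\langle x,y\rangle}\xi_3(\sigma(x),\sigma(y))-\alpha\sum_{x\in V}\sigma(x)$$ is non-empty.
   Context: Tree. Let $\Gamma^k=(V,L)$ be the Cayley tree of order $k\in\mathbb{N}$ (the infinite tree in which every vertex has exactly $k+1$ incident edges), with a fixed root $x^0\in V$ and graph distance $d$. Put $W_n=\{x\in V:d(x,x^0)=n\}$, $V_n=\{x\in V:d(x,x^0)\le n\}$, and for $x\in W_n$ let $S(x)=\{y\in W_{n+1}:d(x,y)=1\}$ be its set of direct successors ($k$ elements if $x\ne x^0$, $k+1$ if $x=x^0$), listed in a fixed order. A triple of neighbors $\langle y,x,z\rangle$ consists of a vertex $x$ and two distinct $y,z\in S(x)$ (each unordered pair counted once, $y$ listed before $z$); second neighbors $\rangle y,z\langle$ are the pairs of distinct $y,z\in S(x)$ for some $x$ (same convention); nearest neighbors $\langle x,y\rangle$ are the edges, listed with $y\in S(x)$. Model. The spin takes values in $[0,1]$. For $A\subset V$, $\Omega_A=[0,1]^A$ is the set of configurations on $A$, $\Omega=\Omega_V$, and $\lambda_A$ is the product over $A$ of Lebesgue measure on $[0,1]$. The functions $\xi_1:[0,1]^3\to\mathbb{R}$ and $\xi_2,\xi_3:[0,1]^2\to\mathbb{R}$ are bounded and measurable, $J,J_1,J_3,\alpha\in\mathbb{R}\setminus\{0\}$,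 and $\beta>0$. For $\sigma_n\in\Omega_{V_n}$, $H(\sigma_n)$ denotes the Hamiltonian with all sums restricted to triples, pairs, edges and vertices contained in $V_n$. Splitting Gibbs measures. Let $h:[0,1]\times(V\setminus\{x^0\})\to\mathbb{R}$, $h(t,x)=h_{t,x}$, satisfy $|h_{t,x}|<C$, where $C$ is a constant not depending on $t$. For $n\ge1$ let $\mu^{(n)}$ be the probability distribution on $\Omega_{V_n}$ with density with respect to $\lambda_{V_n}$ $$\mu^{(n)}(\sigma_n)=Z_n^{-1}\exp\Big(-\beta H(\sigma_n)+\sum_{x\in W_n}h_{\sigma_n(x),x}\Big),$$ where $Z_n$ is the normalizing constant (partition function). The distributions $\mu^{(n)}$ are compatible if for every $n\ge2$ and $\sigma_{n-1}\in\Omega_{V_{n-1}}$ $$\int_{\Omega_{W_n}}\mu^{(n)}(\sigma_{n-1}\vee\omega_n)\,\lambda_{W_n}(d\omega_n)=\mu^{(n-1)}(\sigma_{n-1}),$$ where $\sigma_{n-1}\vee\omega_n\in\Omega_{V_n}$ is the concatenation. If they are compatible, the unique probability measure $\mu$ on $\Omega$ whose marginal on $\Omega_{V_n}$ is $\mu^{(n)}$ for every $n\ge1$ (Kolmogorov's extension theorem) is called the splitting Gibbs measure corresponding to the Hamiltonian and the function $h$. The set of splitting Gibbs measures is the set of all $\mu$ obtained in this way from some $h$. *)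

(* Defs.v *)
From HB Require Import structures.
From mathcomp Require Import all_boot all_order all_algebra.
From mathcomp Require Import finmap.
From mathcomp Require Import all_classical all_reals all_analysis.

Set Implicit Arguments.
Unset Strict Implicit.
Unset Printing Implicit Defensive.

Import Order.TTheory GRing.Theory Num.Theory.
Import numFieldNormedType.Exports.

Local Open Scope classical_set_scope.
Local Open Scope ring_scope.

(** * The Cayley tree *)

Section tree.
Context (V : choiceType) (L : rel V).

Definition walk (x y : V) (n : nat) : Prop :=
  exists p : seq V, [/\ path L x p, last x p = y & size p = n].

(* If x and y were not connected the value would be the dummy 0. *)
Definition gdist (x y : V) : nat :=
  xget 0%N [set n | walk x y n /\ forall m, walk x y m -> (n <= m)%N].

Record cayley_tree (k : nat) : Prop := CayleyTree {
  tree_sym : symmetric L ;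
  tree_irr : irreflexive L ;
  tree_connected : forall x y, exists n, walk x y n ;
  tree_acyclic : forall c : seq V, uniq c -> (2 < size c)%N -> ~~ cycle L c ;
  tree_regular : forall x, ([set y | L x y] #= `I_k.+1)%card }.

Context (x0 : V).

Definition tree_sphere (n : nat) : set V := [set x | gdist x x0 = n].

Definition tree_ball (n : nat) : set V := [set x | (gdist x x0 <= n)%N].

Definition direct_successors (x : V) : set V :=
  [set y | tree_sphere (gdist x x0).+1 y /\ gdist x y = 1%N].

(* S x lists the direct successors of x without repetition; the order of the
   list is the fixed order on them. *)
Definition successor_listing (S : V -> seq V) : Prop :=
  forall x, uniq (S x) /\ [set y | y \in S x] = direct_successors x.

End tree.

Definition listed_before (T : eqType) (s : seq T) (y z : T) : Prop :=
  [/\ y \in s, z \in s & (index y s < index z s)%N].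

(** * Spins and Lebesgue measure on [0, 1] *)

Definition spin (R : realType) : Type := {t : R | 0 <= t <= 1}.

Definition spin_set_system (R : realType) : set (set (spin R)) :=
  preimage_set_system setT (val : spin R -> R) measurable.

Section spin.
Context (R : realType).

Fact spin0_subproof : 0 <= (0 : R) <= 1.
Proof. by rewrite lexx ler01. Qed.

HB.instance Definition _ := Choice.on (spin R).
HB.instance Definition _ :=
  isPointed.Build (spin R) (exist _ (0 : R) spin0_subproof).

Let sigma_algebra_spin : sigma_algebra setT (@spin_set_system R).
Proof. exact/sigma_algebra_preimage/sigma_algebra_measurable. Qed.

Let spin0 : spin_set_system (set0 : set (spin R)).
Proof. by case: sigma_algebra_spin. Qed.

Let spinC (A : set (spin R)) : spin_set_system A -> spin_set_system (~` A).
Proof. by rewrite -setTD; case: sigma_algebra_spin => _ + _; apply. Qed.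

Let spinU (F : (set (spin R))^nat) :
  (forall i, spin_set_system (F i)) -> spin_set_system (\bigcup_i F i).
Proof. by case: sigma_algebra_spin => _ _; apply. Qed.

HB.instance Definition _ := @isMeasurable.Build
  (sigma_display (@spin_set_system R)) (spin R) (@spin_set_system R)
  spin0 spinC spinU.

Definition spin_lebesgue (A : set (spin R)) : \bar R :=
  lebesgue_measure [set val t | t in A].

Lemma measurable_spin_image (A : set (spin R)) :
  measurable A -> measurable [set val t | t in A].
Proof.
move=> [B mB <-].
rewrite (_ : [set _ | _ in _] = [set` `[0, 1]] `&` B).
  by apply: measurableI => //; exact: measurable_itv.
apply/seteqP; split => [_ [t [_ Bt] <-]|r /= [r01 Br]].
  by split => //=; rewrite in_itv/=; exact: (valP t).
by rewrite in_itv/= in r01; exists (exist _ r r01).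
Qed.

Let spin_lebesgue0 : spin_lebesgue set0 = 0%E.
Proof. by rewrite /spin_lebesgue image_set0 measure0. Qed.

Let spin_lebesgue_ge0 A : (0 <= spin_lebesgue A)%E.
Proof. exact: measure_ge0. Qed.

Let spin_lebesgue_sigma_additive : semi_sigma_additive spin_lebesgue.
Proof.
move=> F mF tF mUF; rewrite /spin_lebesgue image_bigcup.
apply: measure_semi_sigma_additive.
- by move=> n; exact: measurable_spin_image.
- apply/trivIsetP => i j _ _ ij.
  rewrite -subset0 => _ [[s Fs <-] [t Ft /val_inj ts]].
  move/trivIsetP : tF => /(_ i j Logic.I Logic.I ij) FiFj0.
  by have : (F i `&` F j) s; [split=> //; rewrite -ts|rewrite FiFj0].
- by rewrite -image_bigcup; exact: measurable_spin_image.
Qed.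

HB.instance Definition _ := isMeasure.Build _ _ _ spin_lebesgue
  spin_lebesgue0 spin_lebesgue_ge0 spin_lebesgue_sigma_additive.

Let spin_lebesgue_setT : spin_lebesgue setT = 1%E.
Proof.
rewrite /spin_lebesgue (_ : [set _ | _ in _] = [set` `[0, 1]]).
  by rewrite lebesgue_measure_itv/= lte_fin ltr01 oppr0 adde0.
apply/seteqP; split => [_ [t _ <-]|r /=]; rewrite /= in_itv/=.
  exact: (valP t).
by move=> r01; exists (exist _ r r01).
Qed.

HB.instance Definition _ :=
  Measure_isProbability.Build _ _ _ spin_lebesgue spin_lebesgue_setT.

End spin.

(** * Configurations with the product sigma-algebra *)

Definition config (R : realType) (K : Type) : Type := K -> spin R.

Definition cylinders (R : realType) (K : Type) : set (set (config R K)) :=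
  \bigcup_(x in [set: K])
    preimage_set_system setT (fun s : config R K => s x) measurable.

Section config.
Context (R : realType) (K : Type).

HB.instance Definition _ := Measurable.copy (config R K)
  (g_sigma_algebraType (@cylinders R K)).

End config.

Section product_lebesgue.
Context (R : realType) (K : choiceType).

Definition config_set (x : K) (p : spin R * config R K) : config R K :=
  fun y => if y == x then p.1 else p.2 y.

Lemma measurable_config_eval (x : K) :
  measurable_fun [set: config R K] (fun s : config R K => s x).
Proof.
move=> _ B mB; rewrite setTI; apply: sub_sigma_algebra.
by exists x => //; exists B => //; rewrite setTI.
Qed.

Lemma measurable_config_set (x : K) :
  measurable_fun [set: spin R * config R K] (config_set x).
Proof.
apply: (@measurability _ _ _ _ _ _ (@cylinders R K)) => //.
move=> _ [_ [y _ [B mB <-]] <-]; rewrite setTI.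
rewrite [X in measurable X](_ : _ =
    [set: spin R * config R K] `&` (fun p => config_set x p y) @^-1` B).
  2: by rewrite !setTI.
rewrite /config_set; case: (y == x).
  exact: measurable_fst.
have : measurable_fun [set: spin R * config R K]
    ((fun s : config R K => s y) \o snd).
  by apply: measurableT_comp; [exact: measurable_config_eval|].
by apply.
Qed.

HB.instance Definition _ (x : K) :=
  isMeasurableFun.Build _ _ _ _ (config_set x) (measurable_config_set x).

(* Coordinates in s are independent and Lebesgue distributed, the others are
   equal to 0. *)
Fixpoint seq_lebesgue (s : seq K) : probability (config R K) R :=
  if s is x :: s' then
    distribution (@spin_lebesgue R \x seq_lebesgue s')%E (config_set x)
  else \d_(point : config R K).

(* The product over K of Lebesgue measure, for a finite type K (the set of all
   elements of K is then enumerated by fset_set). *)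
Definition product_lebesgue : probability (config R K) R :=
  seq_lebesgue (enum_fset (fset_set [set: K])).

Lemma seq_lebesgue_box (s : seq K) (B : K -> set (spin R)) : uniq s ->
  (forall x, measurable (B x)) ->
  seq_lebesgue s [set c | forall x, x \in s -> B x (c x)] =
  (\prod_(x <- s) (@spin_lebesgue R) (B x))%E.
Proof.
move=> + mB; elim: s => [_|x s IH /= /andP[xs us]].
  rewrite big_nil /= (_ : [set _ | _] = setT) ?probability_setT//.
  by apply/seteqP; split.
rewrite big_cons -IH// /distribution /pushforward /=.
have mbox : measurable [set c : config R K | forall y, y \in s -> B y (c y)].
  rewrite (_ : [set _ | _] =
      \bigcap_(y in [set` s]) ((fun c : config R K => c y) @^-1` B y)).
    rewrite bigcap_seq; elim: (s) => [|y r IHr].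
      by rewrite big_nil; exact: measurableT.
    rewrite big_cons; apply: measurableI => //.
    by rewrite -[X in measurable X]setTI; exact: measurable_config_eval.
  by apply/seteqP; split => c /=.
rewrite -product_measure1E//; congr (product_measure1 _ _ _).
apply/seteqP; split => -[t c] /=; rewrite /config_set.
- move=> H; split; first by move: (H x); rewrite mem_head eqxx; apply.
  move=> y ys; move: (H y); rewrite inE ys orbT => /(_ isT) /=.
  by case: eqP ys xs => // -> ->.
- move=> [Bt Bc] y; rewrite inE; case: eqP => [->|_]//= ; exact: Bc.
Qed.

Lemma product_lebesgue_box (B : K -> set (spin R)) :
  finite_set [set: K] -> (forall x, measurable (B x)) ->
  product_lebesgue [set c | forall x, B x (c x)] =
  \big[mule/1%E]_(x \in [set: K]) spin_lebesgue (B x).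
Proof.
move=> finK mB; rewrite /product_lebesgue fsbig_finite//=.
rewrite -seq_lebesgue_box//; congr (_ _).
by apply/seteqP; split => c /= H x // ; apply: H; rewrite in_fset_set// inE.
Qed.

End product_lebesgue.

(** * Hamiltonian and splitting Gibbs measures *)

Section model.
Context (R : realType) (V : choiceType) (L : rel V) (x0 : V) (S : V -> seq V).
Context (xi1 : spin R -> spin R -> spin R -> R).
Context (xi2 xi3 : spin R -> spin R -> R).
Context (J J1 J3 alpha beta : R).

Local Notation ball := (tree_ball L x0).
Local Notation sphere := (tree_sphere L x0).

Definition triples (A : set V) : set (A * A * A) :=
  [set p | listed_before (S (val p.1.2)) (val p.1.1) (val p.2)].

Definition second_neighbors (A : set V) : set (A * A) :=
  [set p | exists x, listed_before (S x) (val p.1) (val p.2)].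

Definition nearest_neighbors (A : set V) : set (A * A) :=
  [set p | val p.2 \in S (val p.1)].

Arguments triples : clear implicits.
Arguments second_neighbors : clear implicits.
Arguments nearest_neighbors : clear implicits.

Definition hamiltonian (n : nat) (s : config R (ball n)) : R :=
  - J3 * \sum_(p \in triples (ball n)) xi1 (s p.1.2) (s p.1.1) (s p.2)
  - J * \sum_(p \in second_neighbors (ball n)) xi2 (s p.1) (s p.2)
  - J1 * \sum_(p \in nearest_neighbors (ball n)) xi3 (s p.1) (s p.2)
  - alpha * \sum_(x \in [set: ball n]) val (s x).

(* The mathematical h lives on V minus x0: the values h t x0 are only seen by
   the measure of index 0, which is never used below. *)
Context (h : spin R -> V -> R).

Definition gibbs_weight (n : nat) (s : config R (ball n)) : R :=
  expR (- beta * hamiltonian s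
        + \sum_(x \in [set x : ball n | sphere n (val x)]) h (s x) (val x)).

Definition partition_function (n : nat) : R :=
  \int[product_lebesgue R (ball n)]_(s in [set: config R (ball n)])
    gibbs_weight s.

Definition gibbs_density (n : nat) (s : config R (ball n)) : R :=
  (partition_function n)^-1 * gibbs_weight s.

Definition finite_volume (n : nat) (B : set (config R (ball n))) : \bar R :=
  (\int[product_lebesgue R (ball n)]_(s in B) (gibbs_density s)%:E)%E.

(* When C is the union of A and B the last branch is not reached. *)
Definition config_concat (A B C : set V) (s : config R A) (w : config R B) :
    config R C :=
  fun x => if insub (val x) is Some a then s a
           else if insub (val x) is Some b then w b else point.

Definition compatible : Prop :=
  forall (n : nat) (s : config R (ball n)), (1 <= n)%N ->
  (\int[product_lebesgue R (sphere n.+1)]_(w in [set: config R (sphere n.+1)])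
     (gibbs_density (config_concat s w : config R (ball n.+1)))%:E)%E
  = (gibbs_density s)%:E.

Definition config_restriction (A : set V) (s : config R V) : config R A :=
  fun x => s (val x).

Definition admissible : Prop :=
  (exists C : R, forall x t, x != x0 -> `|h t x| < C) /\
  (forall x, x != x0 -> measurable_fun setT (h ^~ x)).

End model.

Definition splitting_gibbs_measures (R : realType) (V : choiceType)
    (L : rel V) (x0 : V) (S : V -> seq V)
    (xi1 : spin R -> spin R -> spin R -> R) (xi2 xi3 : spin R -> spin R -> R)
    (J J1 J3 alpha beta : R) : set (probability (config R V) R) :=
  [set mu | exists h : spin R -> V -> R,
    [/\ admissible x0 h,
        compatible L x0 S xi1 xi2 xi3 J J1 J3 alpha beta h &
        forall (n : nat) (B : set (config R (tree_ball L x0 n))),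
          (1 <= n)%N -> measurable B ->
          mu (@config_restriction R V (tree_ball L x0 n) @^-1` B) =
          finite_volume S xi1 xi2 xi3 J J1 J3 alpha beta h B]].

(* Main.v *)
(* Write f_x = exp h_x.  The measures are compatible as soon as, for every
   vertex x, f_x(t) is proportional to the integral over the spins of the
   successors of x of exp(-beta * energy at x) times the product of the f_y.
   This system is solved without any fixed point theorem.  Cutting the tree at
   level N with free boundary condition gives weights f^N_x, normalised to 1 at
   the default spin, that solve it below level N and are bounded above and below
   uniformly in N.  Along an ultrafilter on N, the measures with densities
   prod_y f^N_y converge setwise, and the limits are again measures because they
   are dominated by a multiple of Lebesgue measure; hence the right-hand sides
   converge pointwise to measurable functions of t.  Comparing on boxes, the
   limit of the product measures is the product measure built from the pointwise
   limits of the f^N_x, which therefore solve the system.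

   The measure on the whole tree is obtained from the consistent densities by
   Caratheodory's extension; continuity at the empty set is the Ionescu-Tulcea
   argument, one sphere of the tree at a time. *)

Require Import Defs.
From HB Require Import structures.
From mathcomp Require Import all_boot all_order all_algebra.
From mathcomp Require Import finmap.
From mathcomp Require Import all_classical all_reals all_analysis.
From mathcomp Require Import measurable_realfun.

Set Implicit Arguments.
Unset Strict Implicit.
Unset Printing Implicit Defensive.

Import Order.TTheory GRing.Theory Num.Theory.
Import numFieldNormedType.Exports.

Local Open Scope classical_set_scope.
Local Open Scope ring_scope.

(** * Contents, ultrafilter limits and bounded integrals *)

(** The interaction functions are only bounded and measurable, so the cut weights have no common
    modulus of continuity from which a uniformly convergent subsequence could be drawn. Pointwise
    limits along an ultrafilter do exist, but they need not be measurable, and dominated convergence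
    fails along an ultrafilter; passing to the limit inside the local equation is the real
    difficulty. With limits of measures the spin [t] stays in the kernel, so measurability in [t]
    comes from Tonelli's theorem, and the integral of a limit weight over a set of spins becomes an
    integral of a bounded function against a limit measure.

    The uniform bounds come from a cancellation: if the kernel lies in [[a, b]], its integral
    against a positive weight lies between [a] and [b] times the mass of that weight, so the
    quotient by the value at the default spin lies in [[a / b, b / a]], whatever the depth and the
    branching. The normalisation also disposes of the unknown constant of proportionality, which
    reappears as the limit of the denominators. *)

Section ereal_lemmas.
Local Open Scope ereal_scope.

(** [A] minus the first [n] covering sets decreases to the empty set and, together with those sets,
    covers [A]; finite subadditivity gives the bound in the limit. This turns a content into a
    measure twice: for limits along an ultrafilter and for cylinders. *)
Lemma content_continuous_at_empty d (T : ringOfSetsType d) (R : realType)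
    (mu : {content set T -> \bar R}) :
  (forall G : (set T)^nat, (forall n, measurable (G n)) ->
    (forall m n, (m <= n)%N -> G n `<=` G m) -> \bigcap_n G n = set0 ->
    mu (G n) @[n --> \oo] --> 0) ->
  measurable_subset_sigma_subadditive mu.
Proof.
move=> mu_cont A F mF mA AF.
pose G n : set T := A `\` \big[setU/set0]_(i < n) F i.
have mU n : measurable (\big[setU/set0]_(i < n) F i).
  by apply: bigsetU_measurable => i _; exact: mF.
have mG n : measurable (G n) by exact: measurableD.
have G0 : mu (G n) @[n --> \oo] --> 0.
  apply: mu_cont => // [m n mn c [Ac Fc]|].
    by split=> // Fic; apply: Fc; exact: (@subset_bigsetU _ F _ _ mn).
  rewrite -subset0 => c Gc.
  have [Ac _] := Gc 0%N I.
  have [i _ Fc] := AF _ Ac.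
  have [_] := Gc i.+1 I; apply.
  by rewrite big_ord_recr; right.
pose S := \sum_(0 <= n <oo) mu (F n).
have AG n : mu A <= mu (G n) + S.
  pose F' k := if k is j.+1 then F j else G n.
  apply: (@le_trans _ _ (\sum_(k < n.+1) mu (F' k))).
    apply: content_subadditive => //; first by case=> [|k] _; [exact: mG|exact: mF].
    rewrite big_ord_recl/= => c Ac.
    have [Fc|Fc] := pselect ((\big[setU/set0]_(i < n) F i) c); first by right.
    by left.
  rewrite big_ord_recl/= leeD2l//.
  by rewrite -(big_mkord xpredT (fun i => mu (F i))) nneseries_lim_ge.
have GS : mu (G n) + S @[n --> \oo] --> 0 + S.
  by apply: cvgeD => //; exact: cvg_cst.
rewrite -/S -(add0e S) -(cvg_lim _ GS)//.
by apply: lime_ge; [apply/cvg_ex; exists (0 + S)|exact: nearW].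
Qed.

Lemma cvg_ultra (R : realType) (T : Type) (U : set_system T) (a : T -> \bar R)
    (b : R) : UltraFilter U -> (forall t, 0 <= a t <= b%:E) ->
  exists2 l : R, (0 <= l <= b)%R & a @ U --> l%:E.
Proof.
move=> UU ab.
have afin t : a t \is a fin_num.
  by have /andP[a0 aB] := ab t; rewrite ge0_fin_numE// (le_lt_trans aB) ?ltry.
(* The image of an ultrafilter is again an ultrafilter; compactness of the segment then provides the
   limit. *)
have UaU : UltraFilter (fine \o a @ U).
  have PU : ProperFilter U by exact: ultra_proper.
  constructor; first exact: fmap_proper_filter.
  move=> G PG aG; apply/seteqP; split => // A GA.
  have [//|UC] := in_ultra_setVsetC ((fine \o a) @^-1` A) UU.
  have : G (A `&` ~` A) by apply: filterI => //; exact: aG.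
  by rewrite setICr => /filter_not_empty.
have : compact (`[0%R, b] : set R) by exact: segment_compact.
rewrite compact_ultra => /(_ _ UaU) [].
  apply: (filterE (F := U)) => t /=; rewrite in_itv/=; have := ab t.
  by rewrite -(fineK (afin t)) !lee_fin.
move=> l [/=]; rewrite in_itv/= => lb al; exists l => //.
by apply/fine_cvgP; split => //; exact: nearW.
Qed.

End ereal_lemmas.

Lemma integral_prob_bnd d (T : measurableType d) (R : realType)
    (P : probability T R) (h : T -> R) (l u : R) :
  0 <= l -> measurable_fun [set: T] h -> (forall t, l <= h t <= u) ->
  (l%:E <= \int[P]_t (h t)%:E <= u%:E)%E.
Proof.
move=> l0 mh hb.
have mEh : measurable_fun [set: T] (fun t => (h t)%:E) by exact/measurable_EFinP.
have h0 t : (0 <= (h t)%:E)%E.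
  by rewrite lee_fin (le_trans l0)//; have /andP[] := hb t.
have cstE (r : R) : (\int[P]_t r%:E = r%:E)%E.
  rewrite integral_cst// -[RHS]mule1; congr (_ * _)%E; exact: probability_setT.
rewrite -(cstE l) -(cstE u); apply/andP; split; apply: ge0_le_integral => //.
- by move=> t _; rewrite lee_fin; have /andP[] := hb t.
- by move=> t _; rewrite lee_fin; have /andP[] := hb t.
Qed.

Lemma integral_prob_fin_num d (T : measurableType d) (R : realType)
    (P : probability T R) (h : T -> R) (u : R) :
  measurable_fun [set: T] h -> (forall t, 0 <= h t <= u) ->
  (\int[P]_t (h t)%:E)%E \is a fin_num.
Proof.
move=> mh hb; have /andP[l U] := integral_prob_bnd P (lexx 0) mh hb.
by rewrite ge0_fin_numE// (le_lt_trans U)// ltry.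
Qed.

(** * Integration over finitely many spins *)

Section seq_lebesgue_theory.
Context (R : realType) (K : choiceType).
Implicit Types (s : seq K) (c w : config R K).

Lemma measurable_config_fun d (T : measurableType d) (f : T -> config R K) :
  (forall x, measurable_fun setT (fun t => f t x)) -> measurable_fun setT f.
Proof.
move=> mf; apply: (@measurability _ _ _ _ _ _ (@cylinders R K)) => //.
move=> _ [_ [y _ [B mB <-]] <-]; rewrite !setTI.
by have := mf y measurableT B mB; rewrite setTI.
Qed.

(** The configuration [c] serves as a boundary condition outside [s]. Iterated integrals are written
    with it so that every partial integral lives on one configuration space. *)
Definition splice s w c : config R K := fun x => if x \in s then w x else c x.

Lemma measurable_splice s :
  measurable_fun setT (fun p : config R K * config R K => splice s p.1 p.2).
Proof.
apply: measurable_config_fun => x; rewrite /splice; case: (x \in s).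
  by apply: (measurableT_comp (measurable_config_eval x)).
by apply: (measurableT_comp (measurable_config_eval x)).
Qed.

Lemma measurable_splicel s c : measurable_fun [set: config R K] (fun w => splice s w c).
Proof.
apply: measurable_config_fun => x; rewrite /splice; case: (x \in s) => //.
exact: measurable_config_eval.
Qed.

Lemma measurable_splicer s w : measurable_fun [set: config R K] (splice s w).
Proof.
apply: measurable_config_fun => x; rewrite /splice; case: (x \in s) => //.
exact: measurable_config_eval.
Qed.

Lemma integral_seq_lebesgue_cons x s (F : config R K -> \bar R) :
  measurable_fun [set: config R K] F -> (forall c, 0 <= F c)%E ->
  (\int[seq_lebesgue R (x :: s)]_c F c =
   \int[@spin_lebesgue R]_t \int[seq_lebesgue R s]_c F (config_set x (t, c)))%E.
Proof.
move=> mF F0.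
rewrite /= ge0_integral_pushforward//=.
rewrite preimage_setT fubini_tonelli1//.
by apply: measurableT_comp => //; exact: measurable_config_set.
Qed.

Lemma integral_seq_lebesgue_nil (F : config R K -> \bar R) :
  measurable_fun [set: config R K] F ->
  (\int[seq_lebesgue R ([::] : seq K)]_c F c = F point)%E.
Proof. by move=> mF; rewrite /= integral_dirac// diracT mul1e. Qed.

Lemma measurable_comp_config_set x t (F : config R K -> \bar R) :
  measurable_fun [set: config R K] F ->
  measurable_fun [set: config R K] (fun c => F (config_set x (t, c))).
Proof.
move=> mF; apply: (measurableT_comp mF).
by apply: (measurableT_comp (@measurable_config_set R K x)).
Qed.

Lemma measurable_integral_splicer s s' (F : config R K -> \bar R) :
  measurable_fun [set: config R K] F -> (forall c, 0 <= F c)%E ->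
  measurable_fun [set: config R K]
    (fun w => \int[seq_lebesgue R s']_w' F (splice s w w'))%E.
Proof.
move=> mF F0.
have mG := measurableT_comp mF (measurable_splice s).
apply: (measurable_fun_fubini_tonelli_F (m2 := seq_lebesgue R s') _ mG) => p; exact: F0.
Qed.

Lemma measurable_integral_splicel s s' (F : config R K -> \bar R) :
  measurable_fun [set: config R K] F -> (forall c, 0 <= F c)%E ->
  measurable_fun [set: config R K]
    (fun w' => \int[seq_lebesgue R s']_w F (splice s w w'))%E.
Proof.
move=> mF F0.
have mG := measurableT_comp mF (measurable_splice s).
apply: (measurable_fun_fubini_tonelli_G (m1 := seq_lebesgue R s') _ mG) => p; exact: F0.
Qed.

Lemma integral_seq_lebesgue_cat s1 s2 (F : config R K -> \bar R) :
  measurable_fun [set: config R K] F -> (forall c, 0 <= F c)%E ->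
  (\int[seq_lebesgue R (s1 ++ s2)]_c F c =
   \int[seq_lebesgue R s1]_w1 \int[seq_lebesgue R s2]_w2 F (splice s1 w1 w2))%E.
Proof.
elim: s1 F => [|x s1 IH] F mF F0.
  rewrite cat0s integral_seq_lebesgue_nil.
    by apply: eq_integral => c _; congr F; apply/funext.
  exact: measurable_integral_splicer.
rewrite cat_cons !integral_seq_lebesgue_cons//; last 2 first.
  exact: measurable_integral_splicer.
  by move=> c; apply: integral_ge0.
apply: eq_integral => t _; rewrite IH//; last exact: measurable_comp_config_set.
apply: eq_integral => w1 _; apply: eq_integral => w2 _.
congr F; apply/funext => y; rewrite /splice /config_set/= inE.
by case: (y == x).
Qed.

(** Off [s] every spin has the default value: append the empty list, whose measure is the Dirac mass
    at [point]. *)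
Lemma integral_seq_lebesgue_splice_point s (F : config R K -> \bar R) :
  measurable_fun [set: config R K] F -> (forall c, 0 <= F c)%E ->
  (\int[seq_lebesgue R s]_c F c =
   \int[seq_lebesgue R s]_c F (splice s c point))%E.
Proof.
move=> mF F0; rewrite -[in LHS](cats0 s) integral_seq_lebesgue_cat//.
apply: eq_integral => w _; rewrite integral_seq_lebesgue_nil//.
exact: measurableT_comp mF (measurable_splicer _ _).
Qed.

Definition config_box s (B : K -> set (spin R)) : set (config R K) :=
  [set c | forall x, x \in s -> B x (c x)].

Lemma measurable_config_box s B : (forall x, measurable (B x)) ->
  measurable (config_box s B).
Proof.
move=> mB; rewrite (_ : config_box s B =
    \bigcap_(y in [set` s]) ((fun c : config R K => c y) @^-1` B y)).
  rewrite bigcap_seq; elim: s => [|y r IHr].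
    by rewrite big_nil; exact: measurableT.
  rewrite big_cons; apply: measurableI => //.
  by rewrite -[X in measurable X]setTI; exact: measurable_config_eval.
by apply/seteqP; split => c /=.
Qed.

(** Boxes generate the product sigma-algebra and are stable under intersection, so they determine a
    measure of finite mass. *)
Lemma config_measure_unique (m1 m2 : {measure set config R K -> \bar R}) :
  (m1 setT < +oo)%E ->
  (forall s B, (forall x, measurable (B x)) ->
    m1 (config_box s B) = m2 (config_box s B)) ->
  forall A, measurable A -> m1 A = m2 A.
Proof.
move=> m1T m12.
pose G : set (set (config R K)) := [set A | exists s B,
  (forall x, measurable (B x)) /\ A = config_box s B].
have boxT : config_box [::] (fun=> setT) = setT :> set (config R K).
  by apply/seteqP; split.
move=> A mA; apply: (measure_unique G (fun=> setT)) => //.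
- apply/seteqP; split.
    apply: smallest_sub; first exact: smallest_sigma_algebra.
    move=> _ [x _ [B mB <-]]; apply: sub_sigma_algebra.
    exists [:: x], (fun=> B); split => //; rewrite setTI.
    apply/seteqP; split => c /= Bc; last by apply: Bc; rewrite mem_head.
    by move=> y; rewrite inE => /eqP ->.
  apply: smallest_sub; first exact: sigma_algebra_measurable.
  by move=> _ [s [B [mB ->]]]; exact: measurable_config_box.
- move=> _ _ [s [B [mB ->]]] [s' [B' [mB' ->]]].
  exists (s ++ s'), (fun x => (if x \in s then B x else setT) `&`
    (if x \in s' then B' x else setT)); split.
    by move=> x; apply: measurableI; case: ifP.
  apply/seteqP; split => c /=.
    by move=> [Bc B'c] x _; split; case: ifPn => // xs; [exact: Bc|exact: B'c].
  move=> H; split => x xs; have := H x; rewrite mem_cat xs ?orbT => /(_ isT)[].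
    by [].
  by [].
- by move=> _; exists [::], (fun=> setT); split.
- by rewrite bigcup_const.
- by move=> _ [s [B [mB ->]]]; exact: m12.
Qed.

Lemma perm_seq_lebesgue s s' : uniq s -> perm_eq s s' ->
  forall A, measurable A -> seq_lebesgue R s A = seq_lebesgue R s' A.
Proof.
move=> us ss'.
apply: config_measure_unique => [|r B mB]; first exact: fin_num_fun_lty.
have intE s1 : seq_lebesgue R s1 (config_box r B) =
    seq_lebesgue R s1 [set c | config_box r B (splice s1 c point)].
  have mb := measurable_config_box r mB.
  have mb' : measurable [set c | config_box r B (splice s1 c point)].
    rewrite -[X in measurable X]setTI.
    exact: measurable_splicel.
  have iE A : measurable A ->
      seq_lebesgue R s1 A = (\int[seq_lebesgue R s1]_c (\1_A c)%:E)%E.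
    by move=> mA; rewrite integral_indic// setIT.
  rewrite !iE//.
  rewrite integral_seq_lebesgue_splice_point//.
  - by apply/measurable_EFinP; exact: measurable_indic.
suff : seq_lebesgue R s (config_box r B) = seq_lebesgue R s' (config_box r B)
  by [].
rewrite !intE.
(* A box may constrain sites outside [s1], where the spin is [point]: its pullback is empty unless
   [point] meets these constraints, and otherwise only the constraints on [s1] remain. *)
have boxE s1 : [set c | config_box r B (splice s1 c point)] =
    if `[< forall x, x \in r -> x \notin s1 -> B x point >] then
    [set c | forall x, x \in s1 -> (if x \in r then B x else setT) (c x)]
    else set0.
  case: ifPn => /asboolP H; apply/seteqP; split => c //=.
  - by move=> Bc x xs; case: ifPn => // xr; have := Bc x xr; rewrite /splice xs.
  - move=> Bc x xr; rewrite /splice; case: ifPn => xs; last exact: H.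
    by have := Bc x xs; rewrite xr.
  - move=> Bc; apply: H => x xr xs.
    by have := Bc x xr; rewrite /splice (negbTE xs).
have eqs : (s =i s') by exact: perm_mem.
rewrite !boxE; under [in RHS]eq_forall do rewrite -eqs.
case: ifPn => _; last by rewrite !measure0.
have mB' x : measurable (if x \in r then B x else setT) by case: ifP.
pose B' x := if x \in r then B x else setT.
transitivity (\prod_(x <- s) (@spin_lebesgue R) (B' x))%E.
  exact: (seq_lebesgue_box us mB').
rewrite (perm_big _ ss'); symmetry; apply: (seq_lebesgue_box _ mB').
by rewrite -(perm_uniq ss').
Qed.

Lemma perm_integral_seq_lebesgue s s' (F : config R K -> \bar R) :
  uniq s -> perm_eq s s' ->
  (\int[seq_lebesgue R s]_c F c = \int[seq_lebesgue R s']_c F c)%E.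
Proof.
move=> us ss'; apply: eq_measure_integral => A mA _.
exact: perm_seq_lebesgue.
Qed.

Definition local_to s T (F : config R K -> T) :=
  forall c c', {in s, c =1 c'} -> F c = F c'.

Lemma integral_seq_lebesgue_indep s1 s2 (F G : config R K -> \bar R) :
  uniq (s1 ++ s2) ->
  measurable_fun [set: config R K] F -> (forall c, 0 <= F c)%E ->
  measurable_fun [set: config R K] G -> (forall c, 0 <= G c)%E ->
  local_to s1 F -> local_to s2 G ->
  (\int[seq_lebesgue R (s1 ++ s2)]_c (F c * G c) =
   \int[seq_lebesgue R s1]_c F c * \int[seq_lebesgue R s2]_c G c)%E.
Proof.
rewrite cat_uniq => /and3P[_ /hasPn s12 _] mF F0 mG G0 lF lG.
rewrite integral_seq_lebesgue_cat; last 2 first.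
- exact: emeasurable_funM.
- by move=> c; exact: mule_ge0.
rewrite -ge0_integralZr//; last by apply: integral_ge0.
apply: eq_integral => w _; rewrite -ge0_integralZl//.
apply: eq_integral => w' _; congr (_ * _)%E.
  by apply: lF => x xs; rewrite /splice xs.
by apply: lG => x xs; rewrite /splice (negbTE (s12 x xs)).
Qed.

(** Disjoint lists of sites are independent. Applied to the successor lists of a sphere, this
    factorises the integral over the next sphere. *)
Lemma integral_seq_lebesgue_flatten (I : Type) (r : seq I) (S : I -> seq K)
    (F : I -> config R K -> \bar R) :
  uniq (flatten [seq S i | i <- r]) ->
  (forall i, measurable_fun [set: config R K] (F i)) ->
  (forall i c, 0 <= F i c)%E -> (forall i, local_to (S i) (F i)) ->
  (\int[seq_lebesgue R (flatten [seq S i | i <- r])]_c \prod_(i <- r) F i c =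
   \prod_(i <- r) \int[seq_lebesgue R (S i)]_c F i c)%E.
Proof.
move=> + mF F0 lF.
have m_prod (r' : seq I) :
    measurable_fun [set: config R K] (fun c => \prod_(i <- r') F i c)%E.
  elim: r' => [|i r' IH].
    rewrite (_ : (fun c => _) = cst 1%E); first exact: measurable_cst.
    by apply/funext => c; rewrite big_nil.
  rewrite (_ : (fun c => _) = (fun c => F i c * \prod_(i <- r') F i c)%E).
    exact: emeasurable_funM.
  by apply/funext => c; rewrite big_cons.
have prod_ge0 (r' : seq I) c : (0 <= \prod_(i <- r') F i c)%E.
  by apply: prode_ge0.
elim: r => [_|i r IH /= us].
  rewrite big_nil; under eq_integral do rewrite big_nil.
  by rewrite integral_cst// mul1e; exact: probability_setT.
rewrite big_cons -IH; last by move: us; rewrite cat_uniq => /and3P[].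
rewrite -integral_seq_lebesgue_indep//.
  by apply: eq_integral => c _; rewrite big_cons.
move=> c c' cc'; elim: (r) cc' => [|j r' IHr] cc'; first by rewrite !big_nil.
rewrite !big_cons (lF j c c') ?IHr//.
  by move=> x xs; apply: cc'; rewrite /= mem_cat xs orbT.
by move=> x xs; apply: cc'; rewrite /= mem_cat xs.
Qed.

End seq_lebesgue_theory.

(** Moves integrals from the configurations of a subset to those of the whole type, so that all
    finite volumes can be compared in one space. *)
Lemma integral_seq_lebesgue_val (R : realType) (K : choiceType) (A : set K)
    (s : seq A) (F : config R A -> \bar R) :
  measurable_fun [set: config R A] F -> (forall c, 0 <= F c)%E ->
  (\int[seq_lebesgue R s]_c F c =
   \int[seq_lebesgue R (map val s)]_c F (config_restriction c))%E.
Proof.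
have mres : measurable_fun [set: config R K] (@config_restriction R K A).
  apply: measurable_config_fun => x; exact: measurable_config_eval.
elim: s F => [|x s IH] F mF F0.
  rewrite !integral_seq_lebesgue_nil//; exact: measurableT_comp mF mres.
rewrite map_cons !integral_seq_lebesgue_cons//; last first.
  exact: measurableT_comp mF mres.
apply: eq_integral => t _; rewrite IH//; last exact: measurable_comp_config_set.
Qed.

(** * Ultrafilter limits of measures with bounded densities *)

Section ultralimit_measure.
Import HBNNSimple.
Context d (T : measurableType d) (R : realType) (P : probability T R).
Context (U : set_system nat) (UU : UltraFilter U).
Context (u : nat -> T -> R) (M : R).
Context (mu : forall N, measurable_fun [set: T] (u N)).
Context (u_bnd : forall N t, 0 <= u N t <= M).

Let I N (phi : T -> R) : \bar R := (\int[P]_t (phi t * u N t)%:E)%E.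

Let PU : ProperFilter U. Proof. exact: ultra_proper. Qed.

Let u_ge0 N t : 0 <= u N t. Proof. by have /andP[] := u_bnd N t. Qed.

Let mphiu N (phi : T -> R) : measurable_fun [set: T] phi ->
  measurable_fun [set: T] (fun t => (phi t * u N t)%:E).
Proof. by move=> mphi; apply/measurable_EFinP; exact: measurable_funM. Qed.

Let I_le N (phi : T -> R) : measurable_fun [set: T] phi -> (forall t, 0 <= phi t) ->
  (I N phi <= M%:E * \int[P]_t (phi t)%:E)%E.
Proof.
move=> mphi phi0.
have M0 : 0 <= M by have /andP[/le_trans] := u_bnd N point; apply.
rewrite -ge0_integralZl//; last 2 first.
- by apply/measurable_EFinP.
- by move=> t _; rewrite lee_fin.
apply: ge0_le_integral => //.
- by move=> t _; rewrite lee_fin mulr_ge0.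
- exact: mphiu.
- by apply/measurable_EFinP; exact: measurable_funM.
- by move=> t _; rewrite lee_fin mulrC ler_wpM2r//; have /andP[] := u_bnd N t.
Qed.

Let I_ge0 N (phi : T -> R) : (forall t, 0 <= phi t) -> (0 <= I N phi)%E.
Proof.
by move=> phi0; apply: integral_ge0 => t _; rewrite lee_fin mulr_ge0.
Qed.

Let ID N (phi psi : T -> R) : measurable_fun [set: T] phi -> (forall t, 0 <= phi t) ->
  measurable_fun [set: T] psi -> (forall t, 0 <= psi t) ->
  I N (fun t => phi t + psi t) = (I N phi + I N psi)%E.
Proof.
move=> mphi phi0 mpsi psi0; rewrite /I -ge0_integralD//.
- by apply: eq_integral => t _; rewrite mulrDl EFinD.
- by move=> t _; rewrite lee_fin mulr_ge0.
- exact: mphiu.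
- by move=> t _; rewrite lee_fin mulr_ge0.
- exact: mphiu.
Qed.

Let cvg_I (phi : T -> R) b : measurable_fun [set: T] phi -> (forall t, 0 <= phi t <= b) ->
  cvg (I N phi @[N --> U]).
Proof.
move=> mphi phib.
have phi0 t : 0 <= phi t by have /andP[] := phib t.
have [|l _ Il] := @cvg_ultra R nat U (I ^~ phi) (M * b) UU.
  move=> N; rewrite I_ge0//= (le_trans (I_le N mphi phi0))// EFinM lee_pmul//.
  - by rewrite lee_fin; have /andP[/le_trans] := u_bnd N point; apply.
  - by apply: integral_ge0 => t _; rewrite lee_fin.
  - rewrite -[leRHS]mule1 -(probability_setT P) -integral_cst//.
    apply: ge0_le_integral => //.
    + by move=> t _; rewrite lee_fin.
    + exact/measurable_EFinP.
    + by move=> t _; rewrite lee_fin; have /andP[] := phib t.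
by apply/cvg_ex; exists l%:E.
Qed.

Let cvg_I1 A : measurable A -> cvg (I N \1_A @[N --> U]).
Proof.
move=> mA; apply: (@cvg_I _ 1) => [|t]; first exact: measurable_indic.
by rewrite indicE ler0n lern1 leq_b1.
Qed.

Definition ultralimit (A : set T) : \bar R := lim (I N \1_A @[N --> U]).

Let ultralimit_ge0 A : (0 <= ultralimit A)%E.
Proof.
(* Convergence is established for measurable sets only; where it fails, [lim] is a default value,
   which is nonnegative too. *)
rewrite /ultralimit; have [c|/dvgP->//] := pselect (cvg (I N \1_A @[N --> U])).
by apply: lime_ge => //; apply: nearW => N; apply: I_ge0 => t; rewrite indicE.
Qed.

Let ultralimit_additive : measure_function.semi_additive ultralimit.
Proof.
have u0 : ultralimit set0 = 0%E.
  rewrite /ultralimit (_ : (fun N => _) = cst 0%E) ?lim_cst//.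
  apply/funext => N; apply: integral0_eq => t _.
  by rewrite indic0 mul0r.
apply/(additive2P u0) => A B mA mB AB.
rewrite /ultralimit -limeD//; [|exact: cvg_I1|exact: cvg_I1|]; last first.
  by apply: ge0_adde_def; rewrite inE; exact: ultralimit_ge0.
apply: (f_equal (fun f : nat -> \bar R => lim (f @ U))); apply/funext => N; rewrite -ID//.
congr (I N _); apply/funext => t.
rewrite !indicE in_setU; case: (boolP (t \in A)); rewrite ?add0r// inE => At.
case: (boolP (t \in B)); rewrite ?addr0// inE => Bt.
by have : (A `&` B) t by []; rewrite AB.
Qed.

HB.instance Definition _ := isContent.Build _ T R
  ultralimit ultralimit_ge0 ultralimit_additive.

Let ultralimit_le A : measurable A -> (ultralimit A <= M%:E * P A)%E.
Proof.
move=> mA; apply: lime_le; first exact: cvg_I1.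
apply: nearW => N; apply: (le_trans (I_le N _ _)) => //.
by rewrite integral_indic// setIT.
Qed.

Let ultralimit_sigma_subadditive :
  measurable_subset_sigma_subadditive ultralimit.
Proof.
apply: content_continuous_at_empty => G mG G_dec G0.
have PG0 : (M%:E * P (G n))%E @[n --> \oo] --> (M%:E * 0)%E.
  apply: cvgeZl => //; rewrite -(measure0 P) -G0.
  apply: nonincreasing_cvg_mu => //.
  - by rewrite (le_lt_trans (probability_le1 _ _))// ltry.
  - exact: bigcap_measurable.
  - by move=> m n mn; apply/subsetPset; exact: G_dec.
rewrite mule0 in PG0.
apply: (squeeze_cvge _ (cvg_cst 0%E) PG0).
by apply: nearW => n; rewrite ultralimit_ge0/= ultralimit_le.
Qed.

HB.instance Definition _ := Content_SigmaSubAdditive_isMeasure.Build _ R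
  T ultralimit ultralimit_sigma_subadditive.

Let ultralimit_fin_num : fin_num_fun ultralimit.
Proof.
move=> A mA; rewrite ge0_fin_numE// (le_lt_trans (ultralimit_le mA))//.
by rewrite -(fineK (fin_num_measure P _ mA)) -EFinM ltry.
Qed.

HB.instance Definition _ :=
  Measure_isFinite.Build _ T R ultralimit ultralimit_fin_num.

Lemma cvg_ultralimit A : measurable A ->
  (\int[P]_t (\1_A t * u N t)%:E)%E @[N --> U] --> ultralimit A.
Proof. exact: cvg_I1. Qed.

Let cvg_ultralimit_nnsfun (psi : {nnsfun T >-> R}) :
  I N psi @[N --> U] --> (\int[ultralimit]_t (psi t)%:E)%E.
Proof.
rewrite integralT_nnsfun sintegralE fsbig_finite//=.
have r0 r : r \in fset_set (range psi) -> 0 <= r.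
  by rewrite in_fset_set// inE => -[t _ <-].
have -> : I ^~ psi = (fun N => \sum_(r <- fset_set (range psi))
    (r%:E * I N \1_(psi @^-1` [set r])))%E.
  apply/funext => N.
  (* The absolute value makes every term nonnegative, as needed to exchange sum and integral; on the
     range of [psi] it changes nothing. *)
  transitivity (\int[P]_t \sum_(r <- fset_set (range psi))
      (`|r| * (\1_(psi @^-1` [set r]) t * u N t))%:E)%E.
    apply: eq_integral => t _; rewrite [in LHS]fimfunE fsbig_finite//= mulr_suml.
    rewrite sumEFin; congr EFin; rewrite big_seq [RHS]big_seq.
    by apply: eq_bigr => r /r0 rge0; rewrite ger0_norm// mulrA.
  rewrite ge0_integral_sum//; last 2 first.
  - move=> r; apply/measurable_EFinP; apply: measurable_funM => //.
    by apply: measurable_funM => //; exact: measurable_indic.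
  - by move=> r t _; rewrite lee_fin !mulr_ge0// indicE.
  rewrite big_seq [RHS]big_seq; apply: eq_bigr => r /r0 rge0.
  rewrite ger0_norm// -ge0_integralZl//.
  - by apply: mphiu; exact: measurable_indic.
  - by move=> t _; rewrite lee_fin mulr_ge0// indicE.
rewrite big_seq; under eq_fun do rewrite big_seq.
apply: cvg_nnesum => r /r0 rge0.
  by apply: nearW => N; rewrite mule_ge0// I_ge0// => t; rewrite indicE.
by apply: cvgeZl => //; exact: cvg_I1.
Qed.

Lemma cvg_integral_ultralimit (phi : T -> R) b : measurable_fun [set: T] phi ->
  (forall t, 0 <= phi t <= b) ->
  (\int[P]_t (phi t * u N t)%:E)%E @[N --> U] -->
  (\int[ultralimit]_t (phi t)%:E)%E.
Proof.
move=> mphi phib.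
have phi0 t : 0 <= phi t by have /andP[] := phib t.
have b0 : 0 <= b by exact: le_trans (phi0 point) (proj2 (andP (phib point))).
have mEphi : measurable_fun [set: T] (EFin \o phi) by exact/measurable_EFinP.
(* Simple functions increase to [phi]. Replacing [phi] by [psi k] costs at most [M] times the
   integral of [phi - psi k] against [P], uniformly in [N], so the limits in [k] and in [N] can be
   exchanged. *)
pose psi := nnsfun_approx measurableT mEphi.
have psi_phi k t : psi k t <= phi t.
  rewrite -lee_fin /psi nnsfun_approxE; apply: (le_approx (f := EFin \o phi)) => //.
  by move=> x _; rewrite lee_fin.
have psi_cvg t : (psi k t)%:E @[k --> \oo] --> (phi t)%:E.
  by apply: (cvg_nnsfun_approx measurableT mEphi) => // x _; rewrite lee_fin.
have psi_b k t : 0 <= psi k t <= b.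
  by rewrite fun_ge0 (le_trans (psi_phi k t))//; have /andP[] := phib t.
have /cvg_ex[l Il] := cvg_I mphi phib.
suff -> : (\int[ultralimit]_t (phi t)%:E)%E = l by [].
have int_psi : (\int[ultralimit]_t (psi k t)%:E)%E @[k --> \oo] -->
    (\int[ultralimit]_t (phi t)%:E)%E.
  have -> : (\int[ultralimit]_t (phi t)%:E =
      \int[ultralimit]_t limn (fun k => (psi k t)%:E))%E.
    by apply: eq_integral => t _; apply/esym/cvg_lim.
  apply: cvg_monotone_convergence => //.
  - by move=> k; exact/measurable_EFinP.
  - by move=> k t _; rewrite lee_fin.
  - by move=> t _ m n mn; rewrite lee_fin; apply/lefP/nd_nnsfun_approx.
have int_rem : (M%:E * \int[P]_t (phi t - psi k t)%:E)%E @[k --> \oo] --> 0%E.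
  rewrite -(mule0 M%:E); apply: cvgeZl => //.
  have [] := @dominated_convergence _ _ _ P setT measurableT
    (fun k t => (phi t - psi k t)%:E) (cst 0%E) (cst b%:E).
  - by move=> k; apply/measurable_EFinP; exact: measurable_funB.
  - exact: measurable_cst.
  - apply: aeW => t _.
    have := cvgeB (isT : ((phi t)%:E +? - (phi t)%:E)%E) (cvg_cst _) (psi_cvg t).
    by rewrite subee//; apply.
  - exact: finite_measure_integrable_cst.
  - apply: aeW => t k _; rewrite gee0_abs lee_fin; last by rewrite subr_ge0.
    by rewrite lerBlDr (le_trans (proj2 (andP (phib t))))// lerDl fun_ge0.
  - by move=> _ _; rewrite integral_cst// mul0e.
apply/eqP; rewrite eq_le; apply/andP; split.
  apply: (cvge_le _ int_psi); apply: nearW => k.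
  apply: (lee_cvg_to (a := U) (@cvg_ultralimit_nnsfun (psi k)) Il).
  apply: nearW => N; apply: ge0_le_integral => //.
  - by move=> t _; rewrite lee_fin mulr_ge0.
  - exact: mphiu.
  - exact: mphiu.
  - by move=> t _; rewrite lee_fin ler_wpM2r.
rewrite -[leRHS]adde0.
have := cvgeD (fin_num_adde_defl _ (isT : 0%E \is a fin_num)) int_psi int_rem.
move=> /(_ _) lim_sum; apply: (cvge_ge _ lim_sum); apply: nearW => k.
have Ik : (I N (psi k) + M%:E * \int[P]_t (phi t - psi k t)%:E)%E @[N --> U] -->
   (\int[ultralimit]_t (psi k t)%:E + M%:E * \int[P]_t (phi t - psi k t)%:E)%E.
  apply: cvgeD; [|exact: cvg_ultralimit_nnsfun|exact: cvg_cst].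
  apply: ge0_adde_def; rewrite inE.
    by apply: integral_ge0 => t _; rewrite lee_fin.
  rewrite mule_ge0// ?lee_fin; last first.
    by apply: integral_ge0 => t _; rewrite lee_fin subr_ge0.
  by have /andP[/le_trans] := u_bnd 0%N point; apply.
apply: (lee_cvg_to (a := U) Il Ik); apply: nearW => N.
have mrem : measurable_fun [set: T] (fun t => phi t - psi k t).
  exact: measurable_funB.
have rem_ge0 t : 0 <= phi t - psi k t by rewrite subr_ge0.
have -> : I N phi = I N (fun t => psi k t + (phi t - psi k t)).
  by congr (I N _); apply/funext => t; rewrite addrC subrK.
by rewrite ID// leeD2l// I_le.
Qed.

Lemma ultralimit_measure : exists rho : {finite_measure set T -> \bar R},
  (forall A, measurable A ->
    (\int[P]_t (\1_A t * u N t)%:E)%E @[N --> U] --> rho A) /\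
  (forall (phi : T -> R) b, measurable_fun [set: T] phi ->
    (forall t, 0 <= phi t <= b) ->
    (\int[P]_t (phi t * u N t)%:E)%E @[N --> U] -->
    (\int[rho]_t (phi t)%:E)%E).
Proof.
exists ultralimit; split; [exact: cvg_ultralimit|exact: cvg_integral_ultralimit].
Qed.

End ultralimit_measure.

(** * Local equations *)

Section local_equations.
Context (R : realType) (K : choiceType) (S : K -> seq K) (level : K -> nat).
Context (S_uniq : forall x, uniq (S x)).
Context (S_level : forall x y, y \in S x -> level y = (level x).+1).
Context (kappa : K -> spin R -> config R K -> R) (a b : R).
Context (a_gt0 : 0 < a) (ab : a <= b).
Context (kappa_meas : forall x, measurable_fun [set: spin R * config R K]
  (fun p => kappa x p.1 p.2)).
Context (kappa_bnd : forall x t c, a <= kappa x t c <= b).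
Implicit Types (g : K -> spin R -> R) (x y : K) (s : seq K) (t : spin R).

Let b_gt0 : 0 < b. Proof. exact: lt_le_trans ab. Qed.

Let kappa_ge0 x t c : 0 <= kappa x t c.
Proof. by have /andP[+ _] := kappa_bnd x t c; apply: le_trans; exact: ltW. Qed.

(** The bounds are those of a quotient of two local integrals at the same vertex, so the class is
    stable under the normalised equation. *)
Let site_fun g := (forall x, measurable_fun [set: spin R] (g x)) /\
  (forall x t, a / b <= g x t <= b / a).

Let site_fun_gt0 g x t : site_fun g -> 0 < g x t.
Proof.
by move=> [_ /(_ x t)/andP[+ _]]; apply: lt_le_trans; rewrite divr_gt0.
Qed.

Definition site_prod g s (c : config R K) : R := \prod_(y <- s) g y (c y).

Lemma measurable_site_prod g s :
  (forall x, measurable_fun [set: spin R] (g x)) ->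
  measurable_fun [set: config R K] (site_prod g s).
Proof.
move=> mg; rewrite /site_prod; elim: s => [|y s IH].
  rewrite (_ : (fun c => _) = cst 1); first exact: measurable_cst.
  by apply/funext => c; rewrite big_nil.
rewrite (_ : (fun c => _) = (fun c => g y (c y) * \prod_(z <- s) g z (c z))).
  apply: measurable_funM => //.
  exact: measurableT_comp (measurable_config_eval y).
by apply/funext => c; rewrite big_cons.
Qed.

Let site_prod_ge0 g s c : site_fun g -> 0 <= site_prod g s c.
Proof.
by move=> sg; apply: prodr_ge0 => y _; apply: ltW; exact: site_fun_gt0.
Qed.

Let site_prod_bnd g s c : site_fun g ->
  (a / b) ^+ size s <= site_prod g s c <= (b / a) ^+ size s.
Proof.
move=> sg; have [_ bg] := sg; elim: s => [|y s /andP[l u]].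
  by rewrite /site_prod big_nil !expr0 lexx.
have /andP[ly uy] := bg y (c y).
rewrite /site_prod big_cons -/(site_prod g s c) /= !exprS !ler_pM//.
- by rewrite ltW// site_fun_gt0.
- exact: site_prod_ge0.
- by rewrite divr_ge0// ltW.
- by rewrite exprn_ge0// divr_ge0// ltW.
Qed.

Definition local_integral g x t : \bar R :=
  (\int[seq_lebesgue R (S x)]_c (kappa x t c * site_prod g (S x) c)%:E)%E.

Let measurable_kappa x t : measurable_fun [set: config R K] (kappa x t).
Proof. by have := measurableT_comp (kappa_meas x) (pair1_measurable t). Qed.

(** The factor [q] is the integral of the product of the [g y] alone. It does not depend on the spin
    [t] and cancels in the normalised weights; its lower bound keeps the limits of the denominators
    positive. *)
Let local_integral_bnd g x : site_fun g -> exists q : R,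
  [/\ 0 < q, (a / b) ^+ size (S x) <= q <= (b / a) ^+ size (S x) &
      forall t, ((a * q)%:E <= local_integral g x t <= (b * q)%:E)%E].
Proof.
move=> sg; have mp := measurable_site_prod (S x) sg.1.
set l := (a / b) ^+ _; set u := (b / a) ^+ _.
have l_gt0 : 0 < l by rewrite exprn_gt0// divr_gt0.
have /andP[lQ Qu] := integral_prob_bnd (seq_lebesgue R (S x)) (ltW l_gt0) mp
  (fun c => site_prod_bnd (S x) c sg).
set Q := (\int[_]_t _)%E in lQ Qu.
have QE : Q = (fine Q)%:E.
  rewrite fineK// fin_numE gt_eqF ?lt_eqF//.
    by rewrite (le_lt_trans Qu) ?ltry.
  by rewrite (lt_le_trans _ lQ) ?ltNyr.
rewrite QE !lee_fin in lQ Qu.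
exists (fine Q); split; rewrite ?lQ ?Qu//; first exact: lt_le_trans lQ.
have mEp : measurable_fun [set: config R K] (fun c => (site_prod g (S x) c)%:E).
  exact/measurable_EFinP.
have Ep0 c : (0 <= (site_prod g (S x) c)%:E)%E by rewrite lee_fin site_prod_ge0.
have mkp t : measurable_fun [set: config R K]
    (fun c => (kappa x t c * site_prod g (S x) c)%:E).
  by apply/measurable_EFinP; exact: measurable_funM.
have kp0 t c : (0 <= (kappa x t c * site_prod g (S x) c)%:E)%E.
  by rewrite lee_fin mulr_ge0// site_prod_ge0.
have cQ (r : R) : 0 <= r -> (\int[seq_lebesgue R (S x)]_c
    (r * site_prod g (S x) c)%:E = (r * fine Q)%:E)%E.
  by move=> r0; rewrite EFinM -QE -ge0_integralZl.
move=> t; rewrite -(cQ a (ltW a_gt0)) -(cQ b (ltW b_gt0)).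
apply/andP; split; apply: ge0_le_integral => //.
- by move=> c _; rewrite lee_fin mulr_ge0 ?site_prod_ge0// ltW.
- by apply/measurable_EFinP; exact: measurable_funM.
- move=> c _; rewrite lee_fin ler_wpM2r ?site_prod_ge0//.
  by have /andP[] := kappa_bnd x t c.
- by apply/measurable_EFinP; exact: measurable_funM.
- move=> c _; rewrite lee_fin ler_wpM2r ?site_prod_ge0//.
  by have /andP[] := kappa_bnd x t c.
Qed.

Let measurable_local_integral g x : site_fun g ->
  measurable_fun [set: spin R] (local_integral g x).
Proof.
move=> sg.
have mF : measurable_fun [set: spin R * config R K]
    (fun p => (kappa x p.1 p.2 * site_prod g (S x) p.2)%:E).
  apply/measurable_EFinP; apply: measurable_funM => //.
  by apply: measurableT_comp => //; apply: measurable_site_prod; case: sg.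
apply: (measurable_fun_fubini_tonelli_F (m2 := seq_lebesgue R (S x)) _ mF) => p.
by rewrite lee_fin mulr_ge0// site_prod_ge0.
Qed.

Let local_integral_fin g x t : site_fun g ->
  local_integral g x t = (fine (local_integral g x t))%:E.
Proof.
move=> /(local_integral_bnd x)[q [_ _ /(_ t)/andP[l u]]]; rewrite fineK// fin_numE.
by rewrite gt_eqF ?lt_eqF// ?(lt_le_trans _ l) ?(le_lt_trans u) ?ltry ?ltNyr.
Qed.

Let normalized_site_fun g : site_fun g -> site_fun (fun x t =>
  fine (local_integral g x t) / fine (local_integral g x point)).
Proof.
move=> sg; split=> x.
  apply: measurable_funM => //.
  by apply: measurableT_comp; [exact: fine_measurable|exact: measurable_local_integral].
move=> t; have [q [q0 _ bq]] := local_integral_bnd x sg.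
set p := fine (local_integral g x t); set r := fine (local_integral g x point).
have /andP[lp up] : a * q <= p <= b * q.
  by rewrite -!lee_fin -local_integral_fin// bq.
have /andP[lr ur] : a * q <= r <= b * q.
  by rewrite -!lee_fin -local_integral_fin// bq.
have r0 : 0 < r by apply: (lt_le_trans _ lr); rewrite mulr_gt0.
apply/andP; split.
  rewrite ler_pdivlMr// mulrAC ler_pdivrMr//.
  by rewrite (@le_trans _ _ (a * (b * q)))// ?ler_pM2l// mulrCA mulrC ler_pM2r.
rewrite ler_pdivrMr// mulrAC ler_pdivlMr//.
by rewrite (@le_trans _ _ (b * q * a))// ?ler_pM2r// -mulrA ler_pM2l// mulrC.
Qed.

(** The normalised recursion applied [m] times to the constant 1: the weight of a vertex with [m]
    generations of successors kept below it. *)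
Fixpoint iterated_weight m : K -> spin R -> R :=
  if m is j.+1 then fun x t =>
    fine (local_integral (iterated_weight j) x t) /
    fine (local_integral (iterated_weight j) x point)
  else fun _ _ => 1.

Let iterated_weight_site_fun m : site_fun (iterated_weight m).
Proof.
elim: m => [|m IH]; last exact: normalized_site_fun.
split=> [x|x t]; first exact: measurable_cst.
by rewrite ler_pdivrMr// ler_pdivlMr// !mul1r ab.
Qed.

(* The weights of the model cut at level N with free boundary condition. *)
Let cut N x := iterated_weight (N - level x) x.

Let cut_site_fun N : site_fun (cut N).
Proof.
split=> [x|x t]; have [m1 m2] := iterated_weight_site_fun (N - level x).
  exact: m1.
exact: m2.
Qed.

(** A successor is one level higher and has one iteration less. From level [N] on the truncated
    difference is 0 and the weight is 1, hence the restriction to lower levels. *)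
Let cutS N x t : (level x < N)%N ->
  cut N x t = fine (local_integral (cut N) x t) / fine (local_integral (cut N) x point).
Proof.
move=> xN; rewrite {1}/cut -(subnSK xN) /=.
have E t' : local_integral (iterated_weight (N - (level x).+1)) x t' =
    local_integral (cut N) x t'.
  apply: eq_integral => c _; congr (_ * _)%:E; apply: eq_big_seq => y yS.
  by rewrite /cut (S_level yS).
by rewrite !E.
Qed.

(** Peels one site off a box integral, which reduces the convergence of product measures on boxes to
    one-site integrals. *)
Lemma integral_box_site_prod g x s r (B : K -> set (spin R)) : x \notin s ->
  (forall x, measurable_fun [set: spin R] (g x)) -> (forall x t, 0 <= g x t) ->
  (forall y, measurable (B y)) ->
  (\int[seq_lebesgue R (x :: s)]_c
     (\1_(config_box r B) c * site_prod g (x :: s) c)%:E =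
   (\int[@spin_lebesgue R]_t
      (\1_(if x \in r then B x else setT) t * g x t)%:E) *
   \int[seq_lebesgue R s]_c
     (\1_(config_box [seq y <- r | y != x] B) c * site_prod g s c)%:E)%E.
Proof.
move=> xs mg g0 mB.
have pr0 s' c : 0 <= site_prod g s' c by exact: prodr_ge0.
have mbox r' s' : measurable_fun [set: config R K]
    (fun c => (\1_(config_box r' B) c * site_prod g s' c)%:E).
  apply/measurable_EFinP; apply: measurable_funM.
    by apply: measurable_indic; exact: measurable_config_box.
  exact: measurable_site_prod.
have box0 r' s' c : (0 <= (\1_(config_box r' B) c * site_prod g s' c)%:E)%E.
  by rewrite lee_fin mulr_ge0// indicE.
rewrite integral_seq_lebesgue_cons// -ge0_integralZr//; last 3 first.
- apply/measurable_EFinP; apply: measurable_funM => //.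
  by apply: measurable_indic; case: ifP.
- by move=> t _; rewrite lee_fin mulr_ge0// indicE.
- by apply: integral_ge0.
apply: eq_integral => t _; rewrite -ge0_integralZl//; last first.
  by rewrite lee_fin mulr_ge0// indicE.
apply: eq_integral => c _; rewrite -EFinM mulrACA; congr (_ * _)%:E; last first.
  rewrite /site_prod big_cons /config_set/= eqxx; congr (_ * _).
  by apply: eq_big_seq => y ys; case: eqP ys xs => // -> ->.
rewrite !indicE -natrM mulnb; congr (nat_of_bool _)%:R.
apply/idP/andP; rewrite !inE.
  move=> H; split; [|move=> y]; rewrite ?inE.
    by case: ifPn => // xr; have := H x xr; rewrite /config_set/= eqxx.
  rewrite mem_filter => /andP[yx yr]; have := H y yr.
  by rewrite /config_set/= (negbTE yx).
move=> [Ht Hc] y yr; rewrite /config_set/=; case: eqP => [yx|/eqP yx].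
  by move: Ht; rewrite -yx yr.
by apply: Hc; rewrite mem_filter yx.
Qed.

(** Averaging the kernel over the spins in [A] gives a bounded measurable function of the
    configuration, hence a test function for the limits of measures. *)
Let site_average x (A : set (spin R)) (c : config R K) : R :=
  fine (\int[@spin_lebesgue R]_t (\1_A t * kappa x t c)%:E)%E.

Let site_averageE x A c : measurable A ->
  (site_average x A c)%:E = (\int[@spin_lebesgue R]_t (\1_A t * kappa x t c)%:E)%E
  /\ 0 <= site_average x A c <= b.
Proof.
move=> mA.
have mk : measurable_fun [set: spin R] (fun t => \1_A t * kappa x t c).
  apply: measurable_funM; first exact: measurable_indic.
  by have := measurableT_comp (kappa_meas x) (pair2_measurable c).
have kb t : 0 <= \1_A t * kappa x t c <= b.
  have /andP[_ kb] := kappa_bnd x t c.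
  by rewrite mulr_ge0 ?indicE//= (le_trans _ kb)// ler_piMl// lern1 leq_b1.
have /andP[l u] := integral_prob_bnd (@spin_lebesgue R) (lexx 0) mk kb.
have E : (site_average x A c)%:E =
    (\int[@spin_lebesgue R]_t (\1_A t * kappa x t c)%:E)%E.
  by rewrite fineK// ge0_fin_numE// (le_lt_trans u)// ltry.
by split=> //; move: l u; rewrite -E !lee_fin => -> ->.
Qed.

Let measurable_site_average x A : measurable A ->
  measurable_fun [set: config R K] (site_average x A).
Proof.
move=> mA; apply: measurableT_comp; first exact: fine_measurable.
have mF : measurable_fun [set: spin R * config R K]
    (fun p => (\1_A p.1 * kappa x p.1 p.2)%:E).
  apply/measurable_EFinP; apply: measurable_funM => //.
  by apply: measurableT_comp => //; exact: measurable_indic.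
apply: (measurable_fun_fubini_tonelli_G (m1 := @spin_lebesgue R) _ mF) => p.
by rewrite lee_fin mulr_ge0// indicE.
Qed.

(** Tonelli. The measure is arbitrary because the identity serves on both sides of the limit: for
    [seq_lebesgue] with the cut weights as density, and for the limit measure with density 1. *)
Let integral_site_average (m : {sigma_finite_measure set (config R K) -> \bar R})
    x A (v : config R K -> R) : measurable A ->
  measurable_fun [set: config R K] v -> (forall c, 0 <= v c) ->
  (\int[@spin_lebesgue R]_t ((\1_A t)%:E * \int[m]_c (kappa x t c * v c)%:E) =
   \int[m]_c (site_average x A c * v c)%:E)%E.
Proof.
move=> mA mv v0.
have mF : measurable_fun [set: spin R * config R K]
    (fun p => (\1_A p.1 * kappa x p.1 p.2 * v p.2)%:E).
  apply/measurable_EFinP; apply: measurable_funM => //; last first.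
    exact: measurableT_comp.
  apply: measurable_funM => //.
  by apply: measurableT_comp => //; exact: measurable_indic.
have F0 p : (0 <= (\1_A p.1 * kappa x p.1 p.2 * v p.2)%:E)%E.
  by rewrite lee_fin !mulr_ge0// indicE.
transitivity (\int[@spin_lebesgue R]_t \int[m]_c
    (\1_A t * kappa x t c * v c)%:E)%E.
  apply: eq_integral => t _; rewrite -ge0_integralZl//.
  - by apply: eq_integral => c _; rewrite -EFinM mulrA.
  - by apply/measurable_EFinP; exact: measurable_funM.
  - by move=> c _; rewrite lee_fin mulr_ge0.
rewrite (fubini_tonelli _ mF F0).
apply: eq_integral => c _; have [E _] := site_averageE x c mA.
rewrite EFinM E -ge0_integralZr//.
- apply/measurable_EFinP; apply: measurable_funM; first exact: measurable_indic.
  by have := measurableT_comp (kappa_meas x) (pair2_measurable c).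
- by move=> t _; rewrite lee_fin mulr_ge0// indicE.
- by rewrite lee_fin.
Qed.

Lemma local_equations_solvable : exists g (z : K -> R),
  [/\ forall x, measurable_fun [set: spin R] (g x),
      forall x t, a / b <= g x t <= b / a,
      forall x, 0 < z x &
      forall x t, local_integral g x t = (z x * g x t)%:E].
Proof.
have [U [UU Uoo]] := ultraFilterLemma (eventually_filter : ProperFilter \oo).
have PU : ProperFilter U by exact: ultra_proper.
have prod_bnd g s c : site_fun g -> 0 <= site_prod g s c <= (b / a) ^+ size s.
  by move=> sg; rewrite site_prod_ge0//=; have /andP[] := site_prod_bnd s c sg.
have mcut N s : measurable_fun [set: config R K] (site_prod (cut N) s).
  by apply: measurable_site_prod; case: (cut_site_fun N).
have /choice[rho rhoP] := fun s => ultralimit_measure (seq_lebesgue R s) UU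
  (mcut^~ s) (fun N c => prod_bnd _ s c (cut_site_fun N)).
pose G x t := (\int[rho (S x)]_c (kappa x t c)%:E)%E.
have cvgG x t : local_integral (cut N) x t @[N --> U] --> G x t.
  have [_ H] := rhoP (S x); apply: (H _ b); first exact: measurable_kappa.
  by move=> c; rewrite kappa_ge0/=; have /andP[] := kappa_bnd x t c.
pose lo x := a * (a / b) ^+ size (S x).
have lo_gt0 x : 0 < lo x by rewrite mulr_gt0// exprn_gt0// divr_gt0.
have G_bnd x t : ((lo x)%:E <= G x t <= (b * (b / a) ^+ size (S x))%:E)%E.
  apply/andP; split; [apply: (cvge_ge _ (cvgG x t))|apply: (cvge_le _ (cvgG x t))];
    apply: nearW => N;
    have [q [_ /andP[lq qu] /(_ t)/andP[l u]]] := local_integral_bnd x (cut_site_fun N).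
    by apply: le_trans l; rewrite lee_fin ler_pM2l.
  by apply: (le_trans u); rewrite lee_fin ler_pM2l.
have GE x t : G x t = (fine (G x t))%:E.
  have /andP[l u] := G_bnd x t; rewrite fineK// fin_numE.
  by rewrite gt_eqF ?lt_eqF// ?(lt_le_trans _ l) ?(le_lt_trans u) ?ltry ?ltNyr.
have fG_gt0 x t : 0 < fine (G x t).
  by have /andP[+ _] := G_bnd x t; rewrite GE lee_fin; exact: lt_le_trans.
pose z x := fine (G x point).
pose g x t := fine (G x t) / z x.
have cvg_fine x t : fine (local_integral (cut N) x t) @[N --> U] --> fine (G x t).
  by apply: fine_cvg; rewrite -GE.
(* The cut weights solve the equation at [x] only once [N] exceeds the level of [x]; this holds
   along [U] because [U] contains the tails. *)
have after x : \forall N \near U, (level x < N)%N.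
  by apply: Uoo; exact: nbhs_infty_gt.
have cvg_cut x t : cut N x t @[N --> U] --> g x t.
  have H : fine (local_integral (cut N) x t) / fine (local_integral (cut N) x point)
      @[N --> U] --> g x t.
    apply: cvgM => //; apply: cvgV => //.
    by rewrite lt0r_neq0// fG_gt0.
  apply: cvg_trans H; apply: near_eq_cvg.
  by apply: filterS (after x) => N xN; rewrite cutS.
have g_bnd x t : a / b <= g x t <= b / a.
  apply/andP; split; [apply: (cvgr_to_ge (cvg_cut x t))|apply: (cvgr_to_le (cvg_cut x t))];
    by apply: nearW => N; have /andP[] := (cut_site_fun N).2 x t.
(* Measurability is read off the integral against [rho (S x)], which does not depend on [t]; it does
   not follow from the pointwise limit along [U]. *)
have mG x : measurable_fun [set: spin R] (G x).
  have mF : measurable_fun [set: spin R * config R K]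
    (fun p => (kappa x p.1 p.2)%:E) by exact/measurable_EFinP.
  apply: (measurable_fun_fubini_tonelli_F (m2 := rho (S x)) _ mF) => p.
  by rewrite lee_fin.
have mg x : measurable_fun [set: spin R] (g x).
  apply: measurable_funM => //.
  by apply: measurableT_comp; [exact: fine_measurable|exact: mG].
have sg : site_fun g by [].
exists g, z; split=> // [x|]; first exact: fG_gt0.
(* Pointwise convergence along [U] does not imply convergence of integrals. By Tonelli the integral
   over [A] is that of the bounded function [site_average x A] against the converging measures; the
   normalising constants converge separately. *)
have cvg_site x A : measurable A ->
    (\int[@spin_lebesgue R]_t (\1_A t * cut N x t)%:E)%E @[N --> U] -->
    (\int[@spin_lebesgue R]_t (\1_A t * g x t)%:E)%E.
  move=> mA; have fcut N := cut_site_fun N.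
  have m1A : measurable_fun [set: spin R] (\1_A : spin R -> R).
    exact: measurable_indic.
  have A0 t : 0 <= \1_A t :> R by rewrite indicE.
  have avg_bnd c : 0 <= site_average x A c <= b.
    by have [] := site_averageE x c mA.
  have := (rhoP (S x)).2 _ b (measurable_site_average x mA) avg_bnd.
  have -> : (\int[rho (S x)]_c (site_average x A c)%:E =
      (z x)%:E * \int[@spin_lebesgue R]_t (\1_A t * g x t)%:E)%E.
    rewrite -ge0_integralZl//; last 3 first.
    - by apply/measurable_EFinP; exact: measurable_funM.
    - by move=> t _; rewrite lee_fin mulr_ge0// ltW// site_fun_gt0.
    - by rewrite lee_fin ltW// fG_gt0.
    transitivity (\int[rho (S x)]_c (site_average x A c * cst 1 c)%:E)%E.
      by apply: eq_integral => c _; rewrite mulr1.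
    rewrite -integral_site_average//.
    apply: eq_integral => t _.
    rewrite (_ : (\int[_]_c _)%E = G x t); last first.
      by apply: eq_integral => c _; rewrite mulr1.
    rewrite -/(G x t) GE -!EFinM mulrCA; congr (_ * _)%:E.
    by rewrite /g mulrC divfK// lt0r_neq0// fG_gt0.
  have E N : (\int[seq_lebesgue R (S x)]_c
       (site_average x A c * site_prod (cut N) (S x) c)%:E =
     \int[@spin_lebesgue R]_t
       ((\1_A t)%:E * local_integral (cut N) x t))%E.
    rewrite -integral_site_average// => c; exact: site_prod_ge0.
  under eq_fun do rewrite E.
  pose zN N := fine (local_integral (cut N) x point).
  have zN_gt0 N : 0 < zN N.
    have [q [q0 _ /(_ point)/andP[l _]]] := local_integral_bnd x (fcut N).
    move: l; rewrite (local_integral_fin x point (fcut N)) lee_fin.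
    by apply: lt_le_trans; rewrite mulr_gt0.
  have cvg_zN : (zN N)^-1%:E @[N --> U] --> (z x)^-1%:E.
    apply: cvg_EFin; first exact: nearW.
    by apply: cvgV; [rewrite lt0r_neq0// fG_gt0|exact: cvg_fine].
  have g_fin : (\int[@spin_lebesgue R]_t (\1_A t * g x t)%:E)%E \is a fin_num.
    apply: (@integral_prob_fin_num _ _ _ (@spin_lebesgue R) _ (b / a)).
      exact: measurable_funM.
    move=> t; have /andP[_ gb] := g_bnd x t.
    rewrite mulr_ge0//= ?(ltW (site_fun_gt0 _ _ sg))// indicE.
    by rewrite (le_trans _ gb)// ler_piMl ?lern1 ?leq_b1// ltW// site_fun_gt0.
  move=> H; have defM : ((z x)^-1%:E *? ((z x)%:E *
      \int[@spin_lebesgue R]_t (\1_A t * g x t)%:E))%E.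
    by rewrite mule_def_fin// fin_numM.
  have := cvgeM defM cvg_zN H.
  rewrite muleA -EFinM mulVf ?lt0r_neq0 ?fG_gt0// mul1e.
  move=> /(_ _) lim; apply: cvg_trans lim; apply: near_eq_cvg.
  apply: filterS (after x) => N xN; rewrite -ge0_integralZl//.
  - apply: eq_integral => t _; rewrite (local_integral_fin x t (fcut N)) -!EFinM.
    by rewrite cutS// mulrCA; congr (_ * _)%:E; rewrite mulrC.
  - apply: emeasurable_funM; first exact/measurable_EFinP.
    exact: measurable_local_integral.
  - move=> t _; rewrite mule_ge0// ?lee_fin//; apply: integral_ge0 => c _.
    by rewrite lee_fin mulr_ge0// site_prod_ge0.
  - by rewrite lee_fin invr_ge0 ltW.
(* Both sides factorise over the sites of [s]. The list [r] varies in the induction because peeling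
   off a site removes its constraint. *)
have cvg_box s r (B : K -> set (spin R)) : uniq s -> (forall x, measurable (B x)) ->
    (\int[seq_lebesgue R s]_c
      (\1_(config_box r B) c * site_prod (cut N) s c)%:E)%E @[N --> U] -->
    (\int[seq_lebesgue R s]_c (\1_(config_box r B) c * site_prod g s c)%:E)%E.
  move=> us mB; elim: s us r => [_ r|x s IH /= /andP[xs us] r].
    have E g' : site_fun g' -> (\int[seq_lebesgue R ([::] : seq K)]_c
        (\1_(config_box r B) c * site_prod g' [::] c)%:E)%E =
        (\1_(config_box r B) (point : config R K))%:E.
      move=> sg'; rewrite integral_seq_lebesgue_nil ?/site_prod ?big_nil ?mulr1//.
      apply/measurable_EFinP; apply: measurable_funM.
        by apply: measurable_indic; exact: measurable_config_box.
      by apply: measurable_site_prod; case: sg'.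
    rewrite E//; under eq_fun do rewrite E//.
    exact: cvg_cst.
  have g'0 g' : site_fun g' -> forall x t, 0 <= g' x t.
    by move=> sg' y t; rewrite ltW// site_fun_gt0.
  rewrite integral_box_site_prod//; last exact: g'0.
  under eq_fun => N do rewrite (integral_box_site_prod r xs (cut_site_fun N).1
    (g'0 _ (cut_site_fun N)) mB).
  have site_bnd c : 0 <= \1_(config_box [seq y <- r | y != x] B) c * site_prod g s c
      <= (b / a) ^+ size s.
    have /andP[p0 pb] := prod_bnd _ s c sg.
    by rewrite mulr_ge0 ?indicE//= (le_trans _ pb)// ler_piMl// lern1 leq_b1.
  apply: cvgeM; [|by apply: cvg_site; case: ifP|exact: IH].
  apply: mule_def_fin.
    apply: (@integral_prob_fin_num _ _ _ (@spin_lebesgue R) _ (b / a)).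
      apply: measurable_funM => //; apply: measurable_indic; by case: ifP.
    move=> t; have /andP[_ gb] := g_bnd x t.
    rewrite mulr_ge0//= ?(ltW (site_fun_gt0 _ _ sg))// indicE//.
    by rewrite (le_trans _ gb)// ler_piMl ?lern1 ?leq_b1// ltW// site_fun_gt0.
  apply: (@integral_prob_fin_num _ _ _ (seq_lebesgue R s) _ ((b / a) ^+ size s)) => //.
  apply: measurable_funM; last exact: measurable_site_prod.
  by apply: measurable_indic; exact: measurable_config_box.
move=> x t; rewrite /g mulrC divfK ?lt0r_neq0 ?fG_gt0// -GE.
(* Applied to a constant sequence, the construction yields the measure with density
   [site_prod g (S x)], together with its integration formula. *)
have [rho' [rho'A rho'phi]] := ultralimit_measure (seq_lebesgue R (S x)) UU
  (fun=> measurable_site_prod (S x) mg) (fun N c => prod_bnd _ (S x) c sg).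
have kb c : 0 <= kappa x t c <= b.
  by rewrite kappa_ge0/=; have /andP[] := kappa_bnd x t c.
have rho'E := rho'phi _ _ (measurable_kappa x t) kb.
transitivity (\int[rho']_c (kappa x t c)%:E)%E.
  by rewrite -(cvg_lim _ rho'E)// lim_cst.
apply: eq_measure_integral => A mA _.
apply: config_measure_unique => // [|r B mB]; first exact: fin_num_fun_lty.
have mbox := measurable_config_box r mB.
(* On a box, the integrals of the cut weights converge to the mass under [rho (S x)] and also to the
   integral of the limit weights, which is the mass under [rho']. *)
have H1 := (rhoP (S x)).1 _ mbox.
have H2 := cvg_box (S x) r B (S_uniq x) mB.
have H3 := rho'A _ mbox.
have e1 := cvg_lim (@ereal_hausdorff R) H1.
have e2 := cvg_lim (@ereal_hausdorff R) H2.
have e3 := cvg_lim (@ereal_hausdorff R) H3.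
rewrite lim_cst// in e3.
exact: etrans (etrans (esym (e3 PU)) (esym (e2 PU))) (e1 PU).
Qed.

End local_equations.

(** * Measures with consistent densities *)

(** The latest block comes first, matching the recursion of the balls of the tree. *)
Fixpoint blocks (K : Type) (s : nat -> seq K) (n : nat) : seq K :=
  if n is m.+1 then s m ++ blocks s m else [::].

Lemma blocks_sub (K : eqType) (s : nat -> seq K) m n x :
  (m <= n)%N -> x \in blocks s m -> x \in blocks s n.
Proof.
move=> /subnK <-; elim: (n - m)%N => // k IH xm.
by rewrite addSn/= mem_cat IH// orbT.
Qed.

(* The blocks are kept as a parameter so that the algebra of cylinders can be
   attached to the type. *)
Definition cylinder_space (R : realType) (K : choiceType) (s : nat -> seq K) :
  Type := config R K.

Section cylinder_algebra.
Context (R : realType) (K : choiceType) (s : nat -> seq K).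

Definition cylinder_at (n : nat) (A : set (config R K)) : Prop :=
  measurable A /\ local_to (blocks s n) A.

Definition block_cylinders : set (set (cylinder_space R s)) :=
  [set A | exists n, cylinder_at n A].

Lemma cylinder_at_le m n A : (m <= n)%N -> cylinder_at m A -> cylinder_at n A.
Proof.
move=> mn [mA lA]; split=> // c c' cc'; apply: lA => x xm.
exact/cc'/(blocks_sub mn).
Qed.

HB.instance Definition _ := Pointed.copy (cylinder_space R s) (config R K).

Let cyl0 : block_cylinders set0.
Proof. by exists 0%N; split. Qed.

Let cylU : setU_closed block_cylinders.
Proof.
move=> A B [m /(cylinder_at_le (leq_maxl m _)) + [n]].
move=> /(_ n)[mA lA] /(cylinder_at_le (leq_maxr m n))[mB lB].
exists (maxn m n); split; first exact: measurableU.
by move=> c c' cc'; rewrite /setU/=; congr (_ \/ _); [exact: lA|exact: lB].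
Qed.

Let cylC : setC_closed block_cylinders.
Proof.
move=> A [n [mA lA]]; exists n; split; first exact: measurableC.
by move=> c c' cc'; rewrite /setC/=; congr (~ _); exact: lA.
Qed.

HB.instance Definition _ := @isAlgebraOfSets.Build
  (sigma_display block_cylinders) (cylinder_space R s) block_cylinders cyl0 cylU cylC.

End cylinder_algebra.

Section consistent_densities.
Context (R : realType) (K : choiceType) (s : nat -> seq K).
Context (d : nat -> config R K -> R).
Context (s_disj : forall n x, x \in s n -> x \notin blocks s n).
Context (s_cover : forall x, exists n, x \in blocks s n).
Context (d_meas : forall n, measurable_fun [set: config R K] (d n)).
Context (d_ge0 : forall n c, 0 <= d n c).
Context (d0 : forall c, d 0%N c = 1).
Context (d_consistent : forall n c,
  (\int[seq_lebesgue R (s n)]_w (d n.+1 (splice (s n) w c))%:E)%E = (d n c)%:E).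
Implicit Types (A G : set (config R K)) (c w : config R K).

Let splice_block n w c : {in blocks s n, splice (s n) w c =1 c}.
Proof.
move=> x xn; rewrite /splice; case: ifPn => // xs.
by have := s_disj xs; rewrite xn.
Qed.

Let phi A n c : \bar R := (\1_A c * d n c)%:E.

Let phi_meas A n : measurable A -> measurable_fun [set: config R K] (phi A n).
Proof.
move=> mA; apply/measurable_EFinP; exact: measurable_funM.
Qed.

Let phi_ge0 A n c : (0 <= phi A n c)%E.
Proof. by rewrite lee_fin mulr_ge0. Qed.

Let phi_le A n c : (phi A n c <= (d n c)%:E)%E.
Proof. by rewrite lee_fin ler_piMl// indicE lern1 leq_b1. Qed.

Let integral_phi_succ A n c : cylinder_at s n A ->
  (\int[seq_lebesgue R (s n)]_w phi A n.+1 (splice (s n) w c))%E = phi A n c.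
Proof.
move=> [mA lA].
have mw : measurable_fun [set: config R K]
    (fun w => (d n.+1 (splice (s n) w c))%:E).
  apply/measurable_EFinP; apply: measurableT_comp (measurable_splicel _ _).
  exact: d_meas.
rewrite /phi EFinM -d_consistent -ge0_integralZl//.
apply: eq_integral => w _; rewrite EFinM; congr (_%:E * _)%E.
rewrite !indicE; congr (nat_of_bool _)%:R.
  by apply/idP/idP; rewrite !inE (lA _ c)//; exact: splice_block.
by move=> w _; rewrite lee_fin.
Qed.

Lemma integral_blocksS n (F : config R K -> \bar R) :
  measurable_fun [set: config R K] F -> (forall c, 0 <= F c)%E ->
  (\int[seq_lebesgue R (blocks s n.+1)]_c F c =
   \int[seq_lebesgue R (blocks s n)]_c
     \int[seq_lebesgue R (s n)]_w F (splice (s n) w c))%E.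
Proof.
move=> mF F0; rewrite /= integral_seq_lebesgue_cat//.
have mG := measurableT_comp mF (measurable_splice (s n)).
exact: (fubini_tonelli (m1 := seq_lebesgue R (s n))
  (m2 := seq_lebesgue R (blocks s n)) _ mG (fun p => F0 _)).
Qed.

Definition block_measure n A : \bar R :=
  (\int[seq_lebesgue R (blocks s n)]_c (\1_A c * d n c)%:E)%E.

Lemma block_measure_le m n A : (m <= n)%N -> cylinder_at s m A ->
  block_measure n A = block_measure m A.
Proof.
move=> /subnK <- cA; elim: (n - m)%N => // k IH.
have ck : cylinder_at s (k + m) A.
  by apply: cylinder_at_le cA; exact: leq_addl.
rewrite addSn -IH /block_measure integral_blocksS//; last 2 first.
- by apply: phi_meas; case: cA.
- exact: phi_ge0.
by apply: eq_integral => c _; exact: integral_phi_succ.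
Qed.

(** Any level at which [A] is a cylinder gives the same mass, by [block_measure_le]; sets that are
    not cylinders get level 0. *)
Let level A : nat := xget 0%N [set n | cylinder_at s n A].

Definition cylinder_measure (A : set (cylinder_space R s)) : \bar R :=
  block_measure (level A) A.

Lemma cylinder_measureE n A :
  cylinder_at s n A -> cylinder_measure A = block_measure n A.
Proof.
move=> cA; have cl : cylinder_at s (level A) A.
  by rewrite /level; case: xgetP => [m _ //|/(_ n)].
rewrite /cylinder_measure -(block_measure_le (leq_maxl _ n) cl).
by rewrite (block_measure_le (leq_maxr _ n) cA).
Qed.

Let cylinder_measure_ge0 A : (0 <= cylinder_measure A)%E.
Proof. by apply: integral_ge0 => c _; exact: phi_ge0. Qed.

Let cylinder_measure0 : cylinder_measure set0 = 0%E.
Proof.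
by apply: integral0_eq => c _; rewrite indic0 mul0r.
Qed.

Let cylinder_measure_additive : measure_function.semi_additive cylinder_measure.
Proof.
apply/(additive2P cylinder_measure0) => A B [m cA] [n cB] AB.
have {}cA := cylinder_at_le (leq_maxl m n) cA.
have {}cB := cylinder_at_le (leq_maxr m n) cB.
have [[mA lA] [mB lB]] := (cA, cB).
have cAB : cylinder_at s (maxn m n) (A `|` B).
  split; first exact: measurableU.
  by move=> c c' cc'; rewrite /setU/=; congr (_ \/ _); [exact: lA|exact: lB].
rewrite (cylinder_measureE cA) (cylinder_measureE cB) (cylinder_measureE cAB).
rewrite -ge0_integralD//; [|by move=> c _; exact: phi_ge0|exact: phi_meas
  |by move=> c _; exact: phi_ge0|exact: phi_meas].
apply: eq_integral => c _; rewrite -EFinD -mulrDl; congr (_ * _)%:E.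
rewrite !indicE in_setU; case: (boolP (c \in A)); rewrite ?add0r// inE => Ac.
case: (boolP (c \in B)); rewrite ?addr0// inE => Bc.
by have : (A `&` B) c by []; rewrite AB.
Qed.

HB.instance Definition _ := isContent.Build _ (cylinder_space R s) R
  cylinder_measure cylinder_measure_ge0 cylinder_measure_additive.

(** Integrates out blocks [n] to [n + k - 1] with the earlier spins frozen at those of [c]. On an
    indicator times the density [d (k + n)] this is [d n c] times a conditional probability given
    the first [n] blocks. *)
Fixpoint integrate_blocks n k (F : config R K -> \bar R) c : \bar R :=
  if k is j.+1 then
    (\int[seq_lebesgue R (s n)]_w integrate_blocks n.+1 j F (splice (s n) w c))%E
  else F c.

Lemma integrate_blocks_ge0 n k (F : config R K -> \bar R) c :
  (forall c, 0 <= F c)%E -> (0 <= integrate_blocks n k F c)%E.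
Proof.
move=> F0; elim: k n c => //= k IH n c.
by apply: integral_ge0 => w _; exact: IH.
Qed.

Lemma measurable_integrate_blocks n k (F : config R K -> \bar R) :
  measurable_fun [set: config R K] F -> (forall c, 0 <= F c)%E ->
  measurable_fun [set: config R K] (integrate_blocks n k F).
Proof.
move=> mF F0; elim: k n => //= k IH n.
apply: measurable_integral_splicel => // c; exact: integrate_blocks_ge0.
Qed.

Lemma integral_integrate_blocks n k (F : config R K -> \bar R) :
  measurable_fun [set: config R K] F -> (forall c, 0 <= F c)%E ->
  (\int[seq_lebesgue R (blocks s (k + n))]_c F c =
   \int[seq_lebesgue R (blocks s n)]_c integrate_blocks n k F c)%E.
Proof.
move=> mF F0; elim: k n => // k IH n.
rewrite addSnnS IH integral_blocksS//.
  exact: measurable_integrate_blocks.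
by move=> c; exact: integrate_blocks_ge0.
Qed.

(** Consistency integrates the later densities back to [d n]; the bound supplies the integrable
    majorant for dominated convergence. *)
Lemma integrate_blocks_le n k A c : measurable A ->
  (integrate_blocks n k (phi A (k + n)) c <= (d n c)%:E)%E.
Proof.
move=> mA; elim: k n c => [|k IH] n c; first exact: phi_le.
rewrite /= -d_consistent addSnnS; apply: ge0_le_integral => //.
- by move=> w _; exact: integrate_blocks_ge0.
- apply: measurableT_comp (measurable_splicel _ _).
  by apply: measurable_integrate_blocks => //; exact: phi_meas.
- apply/measurable_EFinP; apply: measurableT_comp (measurable_splicel _ _).
  exact: d_meas.
Qed.

Lemma integrate_blocks_eq0 n k m A G c : G `<=` A ->
  local_to (blocks s n) A -> ~ A c -> integrate_blocks n k (phi G m) c = 0%E.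
Proof.
move=> GA; elim: k n c => [|k IH] n c lA Ac.
  rewrite /= /phi indicE; case: (boolP (c \in G)); last by rewrite mul0r.
  by rewrite inE => /GA.
apply: integral0_eq => w _; apply: IH.
  by move=> c1 c2 c12; apply: lA => x xn; apply: c12; rewrite /= mem_cat xn orbT.
by rewrite (lA _ c)//; exact: splice_block.
Qed.

(** * Continuity of the cylinder measure at the empty set *)

Section continuity_at_empty.
Context (G : nat -> set (config R K)) (l : nat -> nat).
Context (cG : forall i, cylinder_at s (l i) (G i)).
Context (G_dec : forall i j, (i <= j)%N -> G j `<=` G i).

(** By truncated subtraction the density index is the maximum of [l i] and [n]: beyond the level of
    [G i] no block is left to integrate, and the recursion [QS] holds for every [n]. *)
Let Q i n c :=
  integrate_blocks n (l i - n) (phi (G i) (l i - n + n)) c.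

Let mQ i n : measurable_fun [set: config R K] (Q i n).
Proof. by apply: measurable_integrate_blocks => //; apply: phi_meas; case: (cG i). Qed.

Let QS i n c :
  (Q i n c = \int[seq_lebesgue R (s n)]_w Q i n.+1 (splice (s n) w c))%E.
Proof.
rewrite /Q; case: (leqP (l i) n) => [lin|nli].
  have li0 : (l i - n = 0)%N by apply/eqP; rewrite subn_eq0.
  have li1 : (l i - n.+1 = 0)%N by apply/eqP; rewrite subn_eq0 leqW.
  rewrite li0 li1 /= !add0n integral_phi_succ//.
  exact: cylinder_at_le (cG i).
have -> : (l i - n = (l i - n.+1).+1)%N by rewrite subnSK.
by rewrite /= addSnnS.
Qed.

(** Non-convergence to 0 is propagated, with no quantitative lower bound: if every choice of the
    next block led to the limit 0, dominated convergence would give the limit 0 already at stage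
    [n]. *)
Let persistent n c := ~ ((fun i => Q i n c) @ \oo --> 0%E).

Let persistent_succ n c : persistent n c ->
  exists w, persistent n.+1 (splice (s n) w c).
Proof.
move=> pc; apply: contrapT => npc; apply: pc.
have cvg0 w : (fun i => Q i n.+1 (splice (s n) w c)) @ \oo --> 0%E.
  by apply: contrapT => H; apply: npc; exists w.
have mg : measurable_fun [set: config R K]
    (fun w => (d n.+1 (splice (s n) w c))%:E).
  apply/measurable_EFinP; apply: measurableT_comp (measurable_splicel _ _).
  exact: d_meas.
have [] := @dominated_convergence _ _ _ (seq_lebesgue R (s n)) setT measurableT
  (fun i w => Q i n.+1 (splice (s n) w c)) (cst 0%E)
  (fun w => (d n.+1 (splice (s n) w c))%:E).
- by move=> i; apply: measurableT_comp (measurable_splicel _ _); exact: mQ.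
- exact: measurable_cst.
- by apply: aeW => w _; exact: cvg0.
- apply/integrableP; split=> //.
  under eq_integral do rewrite gee0_abs ?lee_fin//.
  by rewrite d_consistent ltry.
- apply: aeW => w i _; rewrite gee0_abs; last exact: integrate_blocks_ge0.
  by apply: integrate_blocks_le; case: (cG i).
- move=> _ _; rewrite integral_cst// mul0e; apply: cvg_trans.
  by apply: near_eq_cvg; near=> i; rewrite QS.
Unshelve. all: by end_near. Qed.

Lemma cylinder_measure_bigcap_neq0 :
  ~ (cylinder_measure (G i) @[i --> \oo] --> 0%E) -> \bigcap_i G i !=set0.
Proof.
move=> nG.
have p0 : persistent 0 point.
  move=> H; apply: nG; apply: cvg_trans H; apply: near_eq_cvg; near=> i.
  rewrite (cylinder_measureE (cG i)) /block_measure.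
  rewrite -[in RHS](addn0 (l i)) integral_integrate_blocks; last 2 first.
  - by apply: phi_meas; case: (cG i).
  - by move=> c; exact: phi_ge0.
  rewrite integral_seq_lebesgue_nil /Q ?subn0 ?addn0//.
  apply: measurable_integrate_blocks => [|c]; last exact: phi_ge0.
  by apply: phi_meas; case: (cG i).
(* Outside persistent configurations the choice is a dummy; the sequence [C] stays persistent and
   never meets it. *)
have /choice[next nextP] : forall p : nat * config R K,
    exists w, persistent p.1 p.2 -> persistent p.1.+1 (splice (s p.1) w p.2).
  move=> [n c]; have [/persistent_succ[w pw]|npc] := pselect (persistent n c).
    by exists w.
  by exists point.
pose fix C n := if n is m.+1 then splice (s m) (next (m, C m)) (C m) else point.
have pC n : persistent n (C n) by elim: n => // n IH; exact: (nextP (n, C n) IH).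
have Cle m n : (m <= n)%N -> {in blocks s m, C n =1 C m}.
  move=> /subnK <-; elim: (n - m)%N => // k IH x xm.
  rewrite addSn/= splice_block ?IH//.
  by apply: blocks_sub xm; exact: leq_addl.
(* A site keeps its spin once its block has been chosen, so reading each site at such a stage gives
   one configuration that agrees with [C n] on the first [n] blocks. *)
have /choice[N NP] := s_cover.
pose c x := C (N x) x.
have cC n : {in blocks s n, c =1 C n}.
  move=> x xn; rewrite /c; have [Nn|nN] := leqP (N x) n.
    by rewrite (Cle _ _ Nn).
  by rewrite (Cle _ _ (ltnW nN)).
(* If [c] were outside [G i], its first [l i] blocks would already decide this, and every later
   [G j] would have mass 0 given these blocks, against persistence. *)
exists c => i _; apply: contrapT => Gc; apply: (pC (l i)).
apply: cvg_near_cst; near=> j.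
have ij : (i <= j)%N by near: j; exact: nbhs_infty_ge.
apply: (@integrate_blocks_eq0 _ _ _ (G i)); first exact: G_dec.
  by case: (cG i).
by rewrite -((cG i).2 c)//; exact: cC.
Unshelve. all: by end_near. Qed.

End continuity_at_empty.

Let cylinder_measure_sigma_subadditive :
  measurable_subset_sigma_subadditive cylinder_measure.
Proof.
apply: content_continuous_at_empty => G mG G_dec G0.
have /choice[l cG] : forall n, exists m, cylinder_at s m (G n) by exact: mG.
apply: contrapT => /(cylinder_measure_bigcap_neq0 cG G_dec)[c].
by rewrite G0.
Qed.

HB.instance Definition _ := Content_SigmaSubAdditive_isMeasure.Build _ R
  (cylinder_space R s) cylinder_measure cylinder_measure_sigma_subadditive.

Let extended_space := g_sigma_algebraType (@block_cylinders R K s).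

Let extension : set extended_space -> \bar R :=
  measure_extension cylinder_measure.

HB.instance Definition _ := Measure.on extension.

Let extensionE n A : cylinder_at s n A -> extension A = block_measure n A.
Proof.
move=> cA; rewrite -(cylinder_measureE cA).
by apply: measurable_mu_extE; exists n.
Qed.

Let extensionT : extension setT = 1%E.
Proof.
rewrite (@extensionE 0%N); last by split=> //; exact: measurableT.
rewrite /block_measure (eq_integral (cst 1%E)); last first.
  by move=> c _; rewrite indicE in_setT mul1r d0.
by rewrite integral_cst// mul1e; exact: probability_setT.
Qed.

HB.instance Definition _ := Measure_isProbability.Build _ _ _ extension extensionT.

(** The identity, used to push the extension forward to the product sigma-algebra. It is measurable
    because every site lies in some block, which makes coordinate events cylinders. *)
Let forget_blocks (c : extended_space) : config R K := c.

Let measurable_forget_blocks : measurable_fun setT forget_blocks.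
Proof.
apply: measurable_config_fun => x _ B mB; rewrite setTI.
have [n xn] := s_cover x.
apply: sub_sigma_algebra; exists n; split.
  by rewrite -[X in measurable X]setTI; exact: measurable_config_eval.
by move=> c c' cc'; rewrite /preimage/= /forget_blocks cc'.
Qed.

HB.instance Definition _ :=
  isMeasurableFun.Build _ _ _ _ forget_blocks measurable_forget_blocks.

Lemma consistent_densities_extension : exists mu : probability (config R K) R,
  forall n A, cylinder_at s n A -> mu A = block_measure n A.
Proof.
by exists (distribution extension forget_blocks) => n A; exact: extensionE.
Qed.

End consistent_densities.

(** * The Cayley tree *)

Section cayley_tree_levels.
Context (V : choiceType) (L : rel V) (k : nat) (x0 : V) (S : V -> seq V).
Context (treeL : cayley_tree L k) (listS : successor_listing L x0 S).
Implicit Types (x y z : V) (n : nat).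

Local Notation depth x := (gdist L x x0).

Lemma walk0 x y : walk L x y 0 <-> x = y.
Proof.
split=> [[p [_ <- /eqP]]|->]; last by exists [::].
by rewrite size_eq0 => /eqP ->.
Qed.

Lemma walkS x y n : walk L x y n.+1 <-> exists2 z, L x z & walk L z y n.
Proof.
split=> [[[|z p] [//= /andP[xz pz] py [pn]]]|[z xz [p [pz py pn]]]].
  by exists z => //; exists p.
by exists (z :: p); split; rewrite /= ?xz ?pn.
Qed.

Lemma gdistP x y : walk L x y (gdist L x y) /\
  forall m, walk L x y m -> (gdist L x y <= m)%N.
Proof.
rewrite /gdist; case: xgetP => [n _ //|none].
have [n wn] := tree_connected treeL x y.
have ex : exists m, `[< walk L x y m >] by exists n; apply/asboolP.
exfalso; apply: (none (ex_minn ex)); case: ex_minnP => m /asboolP wm minm.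
by split=> // j wj; apply: minm; apply/asboolP.
Qed.

Lemma gdist_eq0 x y : gdist L x y = 0%N <-> x = y.
Proof.
have [w m] := gdistP x y; split=> [d0|xy]; first by apply/walk0; rewrite -d0.
by apply/eqP; rewrite -leqn0; apply: m; exact/walk0.
Qed.

Lemma gdist_eq1 x y : gdist L x y = 1%N <-> L x y.
Proof.
have [w m] := gdistP x y; split=> [d1|xy].
  by rewrite d1 in w; have /walkS[z xz /walk0 <-] := w.
have : (gdist L x y <= 1)%N by apply: m; apply/walkS; exists y => //; exact/walk0.
rewrite leq_eqVlt ltnS leqn0 => /orP[/eqP //|/eqP/gdist_eq0 xy'].
by move: xy; rewrite xy' (tree_irr treeL).
Qed.

Lemma depth_edge x y : L x y -> (depth x <= (depth y).+1)%N.
Proof.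
move=> xy; have [_ m] := gdistP x x0; apply: m; apply/walkS; exists y => //.
by have [] := gdistP y x0.
Qed.

Lemma successorP x y : y \in S x <-> L x y /\ depth y = (depth x).+1.
Proof.
have [_ ES] := listS x.
have -> : (y \in S x) = direct_successors L x0 x y :> Prop by rewrite -ES.
by rewrite /direct_successors/tree_sphere/= gdist_eq1; tauto.
Qed.

Lemma predecessor_exists y n : depth y = n.+1 ->
  exists x, [/\ L y x, depth x = n & y \in S x].
Proof.
move=> yn; have [] := gdistP y x0; rewrite yn => /walkS[x yx wx] _.
have xn : depth x = n.
  apply/eqP; rewrite eqn_leq; apply/andP; split.
    by have [_] := gdistP x x0; apply.
  by have := depth_edge yx; rewrite yn.
exists x; split=> //; apply/successorP; split; last by rewrite yn xn.
by rewrite (tree_sym treeL).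
Qed.

(* Two distinct vertices of the same depth are joined by a path through smaller
   or equal depths; a common successor would close it to a cycle. *)
Lemma same_depth_path n x x' : depth x = n -> depth x' = n -> x != x' ->
  exists p, [/\ path L x p, last x p = x', uniq (x :: p) &
                forall y, y \in x :: p -> (depth y <= n)%N].
Proof.
elim: n x x' => [|n IH] x x'.
  by move=> /gdist_eq0 -> /gdist_eq0 ->; rewrite eqxx.
move=> xn x'n xx'.
have [u [xu un _]] := predecessor_exists xn.
have [u' [xu' u'n _]] := predecessor_exists x'n.
have neq z z' : depth z = n.+1 -> depth z' = n -> z != z'.
  by move=> zn z'n; apply/eqP => zz'; move: zn; rewrite zz' z'n => /n_Sn.
have [uu'|uu'] := eqVneq u u'.
  exists [:: u; x']; split=> //=.
  - by rewrite xu uu' (tree_sym treeL) xu'.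
  - by rewrite !inE negb_or neq// xx' eq_sym neq.
  - by move=> y; rewrite !inE => /or3P[] /eqP ->; rewrite ?xn ?un ?x'n.
have [p [pp lp up dp]] := IH _ _ un u'n uu'.
have notin z : depth z = n.+1 -> z \notin u :: p.
  by move=> zn; apply/negP => /dp; rewrite zn ltnn.
exists (u :: rcons p x'); split.
- by rewrite /= xu rcons_path pp lp (tree_sym treeL) xu'.
- by rewrite /= last_rcons.
- rewrite -rcons_cons cons_uniq rcons_uniq mem_rcons in_cons negb_or xx' up.
  by rewrite !notin.
- move=> y; rewrite inE -rcons_cons mem_rcons inE => /or3P[/eqP->|/eqP->|/dp].
  + by rewrite xn.
  + by rewrite x'n.
  + exact: leqW.
Qed.

Lemma predecessor_unique x x' y : y \in S x -> y \in S x' -> x = x'.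
Proof.
move=> /successorP[xy dy] /successorP[x'y dy'].
have dx' : depth x' = depth x by apply/succn_inj; rewrite -dy -dy'.
apply/eqP; apply/negPn/negP => xx'.
have [p [pp lp up dp]] := same_depth_path (erefl _) dx' xx'.
have : uniq (y :: x :: p).
  by rewrite cons_uniq up andbT; apply/negP => /dp; rewrite dy ltnn.
move=> /(tree_acyclic treeL) /=; rewrite rcons_path pp lp x'y.
(* Acyclicity concerns cycles of more than two vertices; [p] is not empty because [x] and [x']
   differ. *)
rewrite (tree_sym treeL) xy; case: p lp {pp up dp} => [/= xx'E|z p _ /(_ isT)//].
by rewrite xx'E eqxx in xx'.
Qed.

(** By computation a sphere is the concatenation of the successor lists of the previous one, the
    form in which integrals over it factorise. *)
Fixpoint sphere_seq n : seq V :=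
  if n is m.+1 then flatten [seq S x | x <- sphere_seq m] else [:: x0].

Fixpoint ball_seq n : seq V :=
  if n is m.+1 then sphere_seq m.+1 ++ ball_seq m else sphere_seq 0.

Lemma mem_sphere_seq n x : (x \in sphere_seq n) = (depth x == n).
Proof.
elim: n x => [|n IH] x; first by rewrite inE; apply/eqP/eqP => /gdist_eq0.
apply/flatten_mapP/eqP => [[y]|/predecessor_exists[y [_ yn xy]]].
  by rewrite IH => /eqP <- /successorP[].
by exists y => //; rewrite IH yn.
Qed.

Lemma mem_ball_seq n x : (x \in ball_seq n) = (depth x <= n)%N.
Proof.
elim: n => [|n IH]; first by rewrite [LHS](mem_sphere_seq 0) leqn0.
by rewrite [ball_seq _]/= mem_cat -/(sphere_seq n.+1) mem_sphere_seq IH -leq_eqVlt.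
Qed.

Lemma uniq_flatten_successors (r : seq V) :
  uniq r -> uniq (flatten [seq S x | x <- r]).
Proof.
elim: r => //= x r IH /andP[xr ur]; rewrite cat_uniq IH// andbT.
have [-> _] := listS x; apply/hasPn => y /flatten_mapP[x' x'r yx'].
by apply/negP => yx; rewrite (predecessor_unique yx yx') x'r in xr.
Qed.

Lemma uniq_sphere_seq n : uniq (sphere_seq n).
Proof. by elim: n => //= n; exact: uniq_flatten_successors. Qed.

Lemma sphere_ball_disjoint n x : x \in sphere_seq n.+1 -> x \notin ball_seq n.
Proof. by rewrite mem_sphere_seq mem_ball_seq -ltnNge => /eqP ->. Qed.

Lemma uniq_ball_seq n : uniq (ball_seq n).
Proof.
elim: n => // n IH; rewrite [ball_seq _]/= cat_uniq IH andbT.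
rewrite -/(sphere_seq n.+1) uniq_sphere_seq; apply/hasPn => x xb.
by apply/negP => /sphere_ball_disjoint; rewrite xb.
Qed.

(** Every vertex of the larger ball except the root is a successor of exactly one vertex of the
    smaller ball; this charges the external field at a vertex to its predecessor. *)
Lemma big_ball_seq (R : Type) (idx : R) (op : Monoid.com_law idx) (F : V -> R) n :
  \big[op/idx]_(x <- ball_seq n.+1) F x =
  op (F x0) (\big[op/idx]_(x <- ball_seq n) \big[op/idx]_(y <- S x) F y).
Proof.
elim: n => [|n IH].
  rewrite /= big_cat/= big_seq1 Monoid.mulmC/= !cats0.
  by rewrite big_seq1.
rewrite [in LHS]/= big_cat IH /= Monoid.mulmCA; congr (op _ _).
by rewrite big_cat/=; congr (op _ _); rewrite big_flatten/= big_map.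
Qed.

Lemma size_successors x : (size (S x) <= k.+1)%N.
Proof.
have [uS _] := listS x; have cardL := tree_regular treeL x.
have finL : finite_set [set y | L x y].
  by apply/finite_setP; exists k.+1.
rewrite -(card_fset_set cardL).
apply: uniq_leq_size => // y /successorP[xy _].
by rewrite in_fset_set// inE.
Qed.

End cayley_tree_levels.

(** * Sums over pairs and triples as sums over lists *)

Section hamiltonian_sums.
Context (V : choiceType).

Definition ordered_pairs (s : seq V) : seq (V * V) :=
  [seq p <- [seq (y, z) | y <- s, z <- s] | (index p.1 s < index p.2 s)%N].

Lemma mem_ordered_pairs s p :
  p \in ordered_pairs s <-> listed_before s p.1 p.2.
Proof.
rewrite mem_filter; split=> [/andP[lt /allpairsP[[y z] [/= ys zs pE]]]|[ys zs lt]].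
  by split=> //; rewrite pE.
by rewrite lt /=; apply/allpairsP; exists p; split=> //; case: p {ys zs lt}.
Qed.

Lemma uniq_ordered_pairs s : uniq s -> uniq (ordered_pairs s).
Proof.
by move=> us; apply: filter_uniq; apply: allpairs_uniq => // -[y z] [y' z'] _ _.
Qed.

Lemma size_ordered_pairs s : (size (ordered_pairs s) <= size s * size s)%N.
Proof. by rewrite size_filter (leq_trans (count_size _ _))// size_allpairs. Qed.

(** The Hamiltonian sums over tuples from the subtype of a ball. An injection into tuples of
    vertices turns such a sum into one over a list, which can be split according to predecessors. *)
Lemma fsbig_injective_seq (R : Type) (idx : R) (op : Monoid.com_law idx)
    (I T : choiceType) (v : I -> T) (D : set I) (l : seq T) (F : T -> R) :
  injective v -> uniq l -> (forall t, t \in l <-> exists2 i, D i & v i = t) ->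
  \big[op/idx]_(i \in D) F (v i) = \big[op/idx]_(t <- l) F t.
Proof.
move=> vinj ul lD.
rewrite -(fsbig_image D v F); last by move=> i j _ _; exact: vinj.
rewrite [RHS]fsbig_seq//; apply: eq_fsbigl.
by apply/seteqP; split => t /= /lD.
Qed.

End hamiltonian_sums.

Section hamiltonian_decomposition.
Context (R : realType) (V : choiceType) (L : rel V) (k : nat) (x0 : V).
Context (S : V -> seq V).
Context (treeL : cayley_tree L k) (listS : successor_listing L x0 S).
Context (xi1 : spin R -> spin R -> spin R -> R).
Context (xi2 xi3 : spin R -> spin R -> R).
Context (J J1 J3 alpha : R).

Local Notation ball := (tree_ball L x0).
Local Notation sphere := (tree_sphere L x0).

(** All terms involving successors of [x] are charged to [x], including the external field at the
    successors but not at [x] itself. Only the field at the root remains, as the last term of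
    [hamiltonianE]. *)
Definition site_energy (x : V) (t : spin R) (c : config R V) : R :=
  - J3 * \sum_(p <- ordered_pairs (S x)) xi1 t (c p.1) (c p.2)
  - J * \sum_(p <- ordered_pairs (S x)) xi2 (c p.1) (c p.2)
  - J1 * \sum_(y <- S x) xi3 t (c y)
  - alpha * \sum_(y <- S x) val (c y).

Let uS x : uniq (S x). Proof. by have [] := listS x. Qed.

Let succ_ball n x y : y \in S x -> (y \in ball_seq x0 S n.+1) = (x \in ball_seq x0 S n).
Proof.
by move=> /(successorP treeL listS)[_ dy]; rewrite !(mem_ball_seq treeL listS) dy.
Qed.

Lemma sum_triples n (c : config R V) :
  \sum_(p \in triples S (A := ball n.+1))
    xi1 (c (val p.1.2)) (c (val p.1.1)) (c (val p.2)) =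
  \sum_(x <- ball_seq x0 S n) \sum_(p <- ordered_pairs (S x))
    xi1 (c x) (c p.1) (c p.2).
Proof.
pose v (p : ball n.+1 * ball n.+1 * ball n.+1) : V * V * V :=
  (val p.1.1, val p.1.2, val p.2).
pose l := [seq (p.1, x, p.2) | x <- ball_seq x0 S n, p <- ordered_pairs (S x)].
rewrite (@fsbig_injective_seq _ _ _ _ _ v _ l
  (fun q => xi1 (c q.1.2) (c q.1.1) (c q.2))).
- by rewrite big_allpairs_dep.
- by move=> [[a b] e] [[a' b'] e'] [/val_inj -> /val_inj -> /val_inj ->].
- apply: allpairs_uniq_dep; first exact: uniq_ball_seq treeL listS n.
    by move=> x _; exact: uniq_ordered_pairs.
  by move=> [x [y z]] [x' [y' z']] _ _ /= [<- <- <-].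
move=> [[y x] z]; split.
  move=> /allpairsPdep[x' [[y' z'] [/= x'b /mem_ordered_pairs/= yz [-> -> ->]]]].
  have [yS zS _] := yz.
  have inb w : w \in ball_seq x0 S n.+1 -> w \in ball n.+1.
    by rewrite (mem_ball_seq treeL listS) inE.
  have xb : x' \in ball n.+1.
    by move: x'b; rewrite (mem_ball_seq treeL listS) inE => /leqW.
  have yb : y' \in ball n.+1 by apply: inb; rewrite (succ_ball _ yS).
  have zb : z' \in ball n.+1 by apply: inb; rewrite (succ_ball _ zS).
  by exists (SigSub yb, SigSub xb, SigSub zb).
move=> [[[y' x'] z']] /= yz [<- <- <-]; apply/allpairsPdep.
have [yS zS _] := yz; exists (val x'), (val y', val z'); split=> //.
  rewrite -(succ_ball _ yS) (mem_ball_seq treeL listS).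
  by have := set_valP y'.
exact/mem_ordered_pairs.
Qed.

Lemma sum_second_neighbors n (c : config R V) :
  \sum_(p \in second_neighbors S (A := ball n.+1)) xi2 (c (val p.1)) (c (val p.2)) =
  \sum_(x <- ball_seq x0 S n) \sum_(p <- ordered_pairs (S x)) xi2 (c p.1) (c p.2).
Proof.
pose v (p : ball n.+1 * ball n.+1) : V * V := (val p.1, val p.2).
pose l := [seq p | x <- ball_seq x0 S n, p <- ordered_pairs (S x)].
rewrite (@fsbig_injective_seq _ _ _ _ _ v _ l (fun q => xi2 (c q.1) (c q.2))).
- by rewrite big_allpairs_dep.
- by move=> [a b] [a' b'] [/val_inj -> /val_inj ->].
- apply: allpairs_uniq_dep; first exact: uniq_ball_seq treeL listS n.
    by move=> x _; exact: uniq_ordered_pairs.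
  (* The list keeps the pair and forgets the vertex above it; it has no repetition because
     predecessors are unique. *)
  move=> [x p] [x' p'] /allpairsPdep[x1 [p1 [_ + ->]]].
  move=> + /allpairsPdep[x2 [p2 [_ + ->]]].
  move=> /mem_ordered_pairs[y1 _ _] /mem_ordered_pairs[y2 _ _] /= p12.
  by subst p2; rewrite (predecessor_unique treeL listS y1 y2).
move=> [y z]; split.
  move=> /allpairsPdep[x' [[y' z'] [/= x'b /mem_ordered_pairs/= yz [-> ->]]]].
  have [yS zS _] := yz.
  have inb w : w \in ball_seq x0 S n.+1 -> w \in ball n.+1.
    by rewrite (mem_ball_seq treeL listS) inE.
  have yb : y' \in ball n.+1 by apply: inb; rewrite (succ_ball _ yS).
  have zb : z' \in ball n.+1 by apply: inb; rewrite (succ_ball _ zS).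
  by exists (SigSub yb, SigSub zb) => //; exists x'.
move=> [[y' z']] /= [x yz] [<- <-]; apply/allpairsPdep.
have [yS zS _] := yz; exists x, (val y', val z'); split=> //.
  rewrite -(succ_ball _ yS) (mem_ball_seq treeL listS).
  by have := set_valP y'.
exact/mem_ordered_pairs.
Qed.

Lemma sum_nearest_neighbors n (c : config R V) :
  \sum_(p \in nearest_neighbors S (A := ball n.+1)) xi3 (c (val p.1)) (c (val p.2)) =
  \sum_(x <- ball_seq x0 S n) \sum_(y <- S x) xi3 (c x) (c y).
Proof.
pose v (p : ball n.+1 * ball n.+1) : V * V := (val p.1, val p.2).
pose l := [seq (x, y) | x <- ball_seq x0 S n, y <- S x].
rewrite (@fsbig_injective_seq _ _ _ _ _ v _ l (fun q => xi3 (c q.1) (c q.2))).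
- by rewrite big_allpairs_dep.
- by move=> [a b] [a' b'] [/val_inj -> /val_inj ->].
- apply: allpairs_uniq_dep => //; first exact: uniq_ball_seq treeL listS n.
  by move=> [x y] [x' y'] _ _ /= [<- <-].
move=> [x y]; split.
  move=> /allpairsPdep[x' [y' [/= x'b yS [-> ->]]]].
  have xb : x' \in ball n.+1.
    by move: x'b; rewrite (mem_ball_seq treeL listS) inE => /leqW.
  have yb : y' \in ball n.+1.
    by rewrite inE; move: x'b; rewrite -(succ_ball _ yS) (mem_ball_seq treeL listS).
  by exists (SigSub xb, SigSub yb).
move=> [[x' y']] /= yS [<- <-]; apply/allpairsPdep.
exists (val x'), (val y'); split=> //.
  rewrite -(succ_ball _ yS) (mem_ball_seq treeL listS).
  by have := set_valP y'.
Qed.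

Lemma sum_set_type (A : set V) (D : set A) (l : seq V) (F : V -> R) : uniq l ->
  (forall x, x \in l <-> exists2 a, D a & val a = x) ->
  \sum_(a \in D) F (val a) = \sum_(x <- l) F x.
Proof.
by move=> ul lD; apply: (@fsbig_injective_seq _ _ _ _ _ val) => //; exact: val_inj.
Qed.

Lemma hamiltonianE n (c : config R V) :
  hamiltonian S xi1 xi2 xi3 J J1 J3 alpha
    (config_restriction c : config R (ball n.+1)) =
  \sum_(x <- ball_seq x0 S n) site_energy x (c x) c - alpha * val (c x0).
Proof.
rewrite /hamiltonian sum_triples sum_second_neighbors sum_nearest_neighbors.
rewrite (@sum_set_type (ball n.+1) setT (ball_seq x0 S n.+1) (fun x => val (c x))).
- rewrite big_ball_seq mulrDr opprD addrCA addrC; congr (_ - _).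
  by rewrite /site_energy !sumrB -!mulr_sumr.
- exact: uniq_ball_seq treeL listS n.+1.
move=> x; rewrite (mem_ball_seq treeL listS); split=> [xb|[a _ <-]].
  have xb' : x \in ball n.+1 by rewrite inE.
  by exists (SigSub xb').
by have := set_valP a.
Qed.

Lemma sum_sphere n (c : config R V) (h : spin R -> V -> R) :
  \sum_(x \in [set x : ball n | sphere n (val x)])
    h ((config_restriction c : config R (ball n)) x) (val x) =
  \sum_(x <- sphere_seq x0 S n) h (c x) x.
Proof.
rewrite (@sum_set_type _ _ (sphere_seq x0 S n) (fun x => h (c x) x))//.
  exact: uniq_sphere_seq treeL listS n.
move=> x; rewrite (mem_sphere_seq treeL listS); split=> [/eqP xn|[a + <-]].
  have xb : x \in ball n by rewrite inE /tree_ball/= xn.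
  by exists (SigSub xb).
by move=> /eqP.
Qed.

End hamiltonian_decomposition.

(** * Gibbs measures *)

Lemma ler_norm_sum_size (R : realDomainType) (I : Type) (r : seq I) (F : I -> R) M :
  (forall i, `|F i| <= M) -> `|\sum_(i <- r) F i| <= (size r)%:R * M.
Proof.
move=> FM; apply: (le_trans (ler_norm_sum _ _ _)).
apply: (le_trans (ler_sum _ (fun i _ => FM i))).
by rewrite big_const_seq count_predT iter_addr_0 mulr_natl.
Qed.

Lemma measurable_spin_val (R : realType) :
  measurable_fun [set: spin R] (val : spin R -> R).
Proof. by move=> _ B mB; exists B => //; rewrite setTI. Qed.

(** * Bounds, measurability and locality of the energy at a vertex *)

Section site_energy_theory.
Context (R : realType) (V : choiceType) (S : V -> seq V) (N : nat).
Context (size_S : forall x, (size (S x) <= N)%N).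
Context (xi1 : spin R -> spin R -> spin R -> R).
Context (xi2 xi3 : spin R -> spin R -> R).
Context (bxi1 : exists M : R, forall t u v, `|xi1 t u v| <= M).
Context (bxi2 : exists M : R, forall t u, `|xi2 t u| <= M).
Context (bxi3 : exists M : R, forall t u, `|xi3 t u| <= M).
Context (mxi1 : measurable_fun [set: spin R * spin R * spin R]
  (fun p => xi1 p.1.1 p.1.2 p.2)).
Context (mxi2 : measurable_fun [set: spin R * spin R] (fun p => xi2 p.1 p.2)).
Context (mxi3 : measurable_fun [set: spin R * spin R] (fun p => xi3 p.1 p.2)).
Context (J J1 J3 alpha : R).

Local Notation energy := (site_energy S xi1 xi2 xi3 J J1 J3 alpha).

(** The common bound [N] on the number of successors makes the constant independent of the vertex,
    and with it all bounds on the weights. *)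
Lemma site_energy_bounded : exists E, forall x t c, `|energy x t c| <= E.
Proof.
have [M1 b1] := bxi1; have [M2 b2] := bxi2; have [M3 b3] := bxi3.
have M1_ge0 : 0 <= M1 by exact: le_trans (normr_ge0 _) (b1 point point point).
have M2_ge0 : 0 <= M2 by exact: le_trans (normr_ge0 _) (b2 point point).
have M3_ge0 : 0 <= M3 by exact: le_trans (normr_ge0 _) (b3 point point).
have size_pairs x : (size (ordered_pairs (S x)) <= N * N)%N.
  by rewrite (leq_trans (size_ordered_pairs _))// leq_mul.
have bnd (I : Type) (r : seq I) (F : I -> R) (M a : R) m : 0 <= M ->
    (size r <= m)%N -> (forall i, `|F i| <= M) ->
    `|a * \sum_(i <- r) F i| <= `|a| * (m%:R * M).
  move=> M0 rm FM; rewrite normrM ler_wpM2l//.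
  by rewrite (le_trans (ler_norm_sum_size r FM))// ler_wpM2r// ler_nat.
exists (`|- J3| * ((N * N)%:R * M1) + `|J| * ((N * N)%:R * M2) +
  `|J1| * (N%:R * M3) + `|alpha| * (N%:R * 1)) => x t c.
rewrite /site_energy (le_trans (ler_normB _ _))// lerD//; last first.
  apply: bnd => // y; have /andP[y0 y1] := valP (c y).
  by rewrite ger0_norm.
rewrite (le_trans (ler_normB _ _))// lerD//; last exact: bnd.
by rewrite (le_trans (ler_normB _ _))// lerD//; exact: bnd.
Qed.

Lemma measurable_site_energy x :
  measurable_fun [set: spin R * config R V] (fun p => energy x p.1 p.2).
Proof.
have ev y : measurable_fun [set: spin R * config R V] (fun p => p.2 y).
  exact: measurableT_comp (measurable_config_eval y) measurable_snd.
rewrite /site_energy; apply: measurable_funB; last first.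
  apply: measurable_funM => //; apply: measurable_sum => y.
  exact: measurableT_comp (@measurable_spin_val R) (ev y).
apply: measurable_funB; last first.
  apply: measurable_funM => //; apply: measurable_sum => y.
  exact: (measurableT_comp mxi3 (measurable_fun_pair measurable_fst (ev y))).
apply: measurable_funB.
  apply: measurable_funM => //; apply: measurable_sum => q.
  exact: (measurableT_comp mxi1 (measurable_fun_pair
    (measurable_fun_pair measurable_fst (ev q.1)) (ev q.2))).
apply: measurable_funM => //; apply: measurable_sum => q.
exact: (measurableT_comp mxi2 (measurable_fun_pair (ev q.1) (ev q.2))).
Qed.

Lemma site_energy_local x t c c' :
  {in S x, c =1 c'} -> energy x t c = energy x t c'.
Proof.
move=> cc'; rewrite /site_energy.
have pairE (F G : V * V -> R) : (forall y z, y \in S x -> z \in S x ->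
    F (y, z) = G (y, z)) ->
    \sum_(p <- ordered_pairs (S x)) F p = \sum_(p <- ordered_pairs (S x)) G p.
  move=> FG; apply: eq_big_seq => -[y z] /mem_ordered_pairs[/= yS zS _].
  exact: FG.
congr (- J3 * _ - J * _ - J1 * _ - alpha * _).
- by apply: pairE => y z yS zS /=; rewrite !cc'.
- by apply: pairE => y z yS zS /=; rewrite !cc'.
- by apply: eq_big_seq => y yS; rewrite cc'.
- by apply: eq_big_seq => y yS; rewrite cc'.
Qed.

End site_energy_theory.

(** The order of enumeration does not matter, so the recursive lists of balls and spheres may
    replace the enumeration in [product_lebesgue]. *)
Lemma integral_product_lebesgue (R : realType) (V : choiceType) (A : set V)
    (l : seq V) (F : config R A -> \bar R) :
  uniq l -> (forall x, x \in l <-> A x) ->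
  measurable_fun [set: config R A] F -> (forall c, 0 <= F c)%E ->
  (\int[product_lebesgue R A]_c F c =
   \int[seq_lebesgue R l]_c F (config_restriction c))%E.
Proof.
move=> ul lA mF F0.
have finA : finite_set [set: A].
  apply: (sub_finite_set (B := [set` pmap insub l : seq A])) => // x _.
  by rewrite /= mem_pmap_sub; apply/lA; exact: set_valP.
rewrite /product_lebesgue integral_seq_lebesgue_val//.
apply: perm_integral_seq_lebesgue; first by rewrite (map_inj_uniq val_inj) fset_uniq.
apply: uniq_perm => //; first by rewrite (map_inj_uniq val_inj) fset_uniq.
move=> x; apply/mapP/idP => [[a _ ->]|/lA Ax].
  by apply/lA; exact: set_valP.
exists (SigSub (mem_set Ax)) => //.
by rewrite in_fset_set// inE.
Qed.

Section gibbs.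
Context (R : realType) (k : nat) (V : choiceType) (L : rel V) (x0 : V).
Context (S : V -> seq V).
Context (treeL : cayley_tree L k) (listS : successor_listing L x0 S).
Context (xi1 : spin R -> spin R -> spin R -> R).
Context (xi2 xi3 : spin R -> spin R -> R).
Context (J J1 J3 alpha beta : R).
Context (mxi1 : measurable_fun [set: spin R * spin R * spin R]
  (fun p => xi1 p.1.1 p.1.2 p.2)).
Context (mxi2 : measurable_fun [set: spin R * spin R] (fun p => xi2 p.1 p.2)).
Context (mxi3 : measurable_fun [set: spin R * spin R] (fun p => xi3 p.1 p.2)).

Local Notation ball := (tree_ball L x0).
Local Notation sphere := (tree_sphere L x0).
Local Notation ball_seq := (ball_seq x0 S).
Local Notation sphere_seq := (sphere_seq x0 S).

Definition boltzmann_factor x t c : R :=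
  expR (- beta * site_energy S xi1 xi2 xi3 J J1 J3 alpha x t c).

Local Notation kappa := boltzmann_factor.

Context (a b : R) (a_gt0 : 0 < a) (ab : a <= b).
Context (kappa_bnd : forall x t c, a <= kappa x t c <= b).
Context (f : V -> spin R -> R) (z : V -> R).
Context (f_meas : forall x, measurable_fun [set: spin R] (f x)).
Context (f_bnd : forall x t, a / b <= f x t <= b / a).
Context (z_gt0 : forall x, 0 < z x).
Context (f_sol : forall x t, local_integral S kappa f x t = (z x * f x t)%:E).

Let h t x := ln (f x t).

Let b_gt0 : 0 < b. Proof. exact: lt_le_trans ab. Qed.

Let f_gt0 x t : 0 < f x t.
Proof. by have /andP[+ _] := f_bnd x t; apply: lt_le_trans; rewrite divr_gt0. Qed.

Lemma measurable_boltzmann_factor x :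
  measurable_fun [set: spin R * config R V] (fun p => kappa x p.1 p.2).
Proof.
apply: measurableT_comp; first exact: measurable_expR.
by apply: measurable_funM => //; exact: measurable_site_energy.
Qed.

(** The Gibbs weight of the ball of radius [n.+1] as a function on the whole tree, with the index
    shifted because the measures start at radius 1. The first factor is the field at the root, which
    no [site_energy] contains. *)
Definition tree_weight n (c : config R V) : R :=
  expR (beta * alpha * val (c x0)) *
  \prod_(x <- ball_seq n) kappa x (c x) c *
  \prod_(x <- sphere_seq n.+1) f x (c x).

Lemma gibbs_weightE n c :
  gibbs_weight S xi1 xi2 xi3 J J1 J3 alpha beta h
    (config_restriction c : config R (ball n.+1)) = tree_weight n c.
Proof.
rewrite /gibbs_weight (hamiltonianE treeL listS) (sum_sphere treeL listS n.+1 c h).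
rewrite mulrBr expRD addrC expRD; congr (_ * _ * _).
- by congr expR; rewrite mulNr opprK mulrA.
- by rewrite mulr_sumr expR_sum.
- by rewrite expR_sum; apply: eq_bigr => x _; rewrite lnK// posrE.
Qed.

Lemma tree_weight_gt0 n c : 0 < tree_weight n c.
Proof.
rewrite /tree_weight !mulr_gt0 ?expR_gt0//; apply: prodr_gt0 => x _.
  exact: expR_gt0.
exact: f_gt0.
Qed.

Lemma measurable_tree_weight n : measurable_fun [set: config R V] (tree_weight n).
Proof.
rewrite /tree_weight; apply: measurable_funM; first apply: measurable_funM.
- apply: measurableT_comp; first exact: measurable_expR.
  apply: measurable_funM => //.
  exact: measurableT_comp (@measurable_spin_val R) (measurable_config_eval x0).
- apply: measurable_prod => x _.
  have H := (measurableT_comp (measurable_boltzmann_factor x)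
    (measurable_fun_pair (measurable_config_eval x) (@measurable_id _ _ setT))).
  exact: H.
- apply: measurable_prod => x _.
  exact: measurableT_comp (measurable_config_eval x).
Qed.

Lemma tree_weight_bounded n : exists l u : R,
  0 < l /\ forall c, l <= tree_weight n c <= u.
Proof.
pose bounded (F : config R V -> R) :=
  exists l u : R, 0 < l /\ forall c, l <= F c <= u.
have bM F G : bounded F -> bounded G -> bounded (fun c => F c * G c).
  move=> [l [u [l0 lu]]] [l' [u' [l'0 lu']]]; exists (l * l'), (u * u').
  split=> [|c]; first exact: mulr_gt0.
  have /andP[lF Fu] := lu c; have /andP[lG Gu] := lu' c.
  rewrite !ler_pM// ?(ltW l0) ?(ltW l'0)//.
  - exact: le_trans (ltW l0) lF.
  - exact: le_trans (ltW l'0) lG.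
have bP (r : seq V) F : (forall x, bounded (F x)) ->
    bounded (fun c => \prod_(x <- r) F x c).
  move=> bF; elim: r => [|x r IH].
    by exists 1, 1; split=> // c; rewrite big_nil lexx.
  have [l [u [l0 lu]]] := bM _ _ (bF x) IH.
  by exists l, u; split=> // c; rewrite big_cons.
apply: (bM); first apply: (bM).
- exists (expR (- `|beta * alpha|)), (expR `|beta * alpha|).
  split=> [|c]; first exact: expR_gt0.
  rewrite !ler_expR -ler_norml normrM ler_piMr//.
  by have /andP[c0 c1] := valP (c x0); rewrite ger0_norm.
- by apply: bP => x; exists a, b.
- by apply: bP => x; exists (a / b), (b / a); split=> //; rewrite divr_gt0.
Qed.

Lemma tree_weight_local n c c' :
  {in ball_seq n.+1, c =1 c'} -> tree_weight n c = tree_weight n c'.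
Proof.
move=> cc'.
have sub x m : (m <= n.+1)%N -> x \in ball_seq m -> x \in ball_seq n.+1.
  by rewrite !(mem_ball_seq treeL listS) => mn xm; exact: leq_trans mn.
rewrite /tree_weight cc'; last by rewrite (sub _ 0%N)// inE.
congr (_ * _ * _).
- apply: eq_big_seq => x xn; rewrite /kappa cc' ?(sub _ n)//.
  congr expR; congr (_ * _); apply: site_energy_local => y yS; apply: cc'.
  move: xn; rewrite !(mem_ball_seq treeL listS).
  by have /(successorP treeL listS)[_ ->] := yS.
- apply: eq_big_seq => x xn; rewrite cc'//.
  by rewrite mem_cat xn.
Qed.

(** Given [c], the factors over the sphere of radius [n.+1] depend on disjoint successor lists,
    hence are independent; by the local equation each integrates to [z x * f x (c x)]. *)
Lemma integral_tree_weight n c :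
  (\int[seq_lebesgue R (sphere_seq n.+2)]_w
     (tree_weight n.+1 (splice (sphere_seq n.+2) w c))%:E =
   ((\prod_(x <- sphere_seq n.+1) z x) * tree_weight n c)%:E)%E.
Proof.
have notin x m : (m < n.+2)%N -> x \in sphere_seq m -> x \notin sphere_seq n.+2.
  rewrite !(mem_sphere_seq treeL listS) => mn /eqP ->.
  by rewrite neq_ltn mn.
(* These factors read only spins in the ball of radius [n.+1] and are constant for the integral over
   the new sphere. *)
pose C := expR (beta * alpha * val (c x0)) * \prod_(x <- ball_seq n) kappa x (c x) c.
have wE w : (tree_weight n.+1 (splice (sphere_seq n.+2) w c))%:E =
    (C%:E * \prod_(x <- sphere_seq n.+1)
      (kappa x (c x) w * site_prod f (S x) w)%:E)%E.
  have eqc x m : (m < n.+2)%N -> x \in sphere_seq m ->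
      splice (sphere_seq n.+2) w c x = c x.
    by move=> mn xm; rewrite /splice (negbTE (notin x m mn xm)).
  have eqb x : x \in ball_seq n -> (gdist L x x0 < n.+1)%N.
    by rewrite (mem_ball_seq treeL listS) ltnS.
  have mem_sp x : x \in sphere_seq (gdist L x x0).
    by rewrite (mem_sphere_seq treeL listS).
  have -> : tree_weight n.+1 (splice (sphere_seq n.+2) w c) =
      C * \prod_(x <- sphere_seq n.+1) (kappa x (c x) w * site_prod f (S x) w).
    rewrite /tree_weight (eqc _ 0%N)// ?inE// [ball_seq n.+1]/= big_cat/=.
    rewrite -mulrA -[RHS]mulrA; congr (_ * _); rewrite big_split/= mulrAC mulrC.
    congr (_ * (_ * _)).
    - apply: eq_big_seq => x xn; have dx := eqb x xn.
      rewrite (eqc _ (gdist L x x0))//; last exact: leqW.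
      congr expR; congr (_ * _); apply: site_energy_local => y.
      move=> /(successorP treeL listS)[_ dy]; rewrite (eqc _ (gdist L y x0))//.
      by rewrite dy.
    - apply: eq_big_seq => x xn; rewrite (eqc _ n.+1)//.
      congr expR; congr (_ * _); apply: site_energy_local => y yS.
      rewrite /splice ifT//; apply/flatten_mapP; by exists x.
    - rewrite /= big_flatten/= big_map; apply: eq_big_seq => x xn.
      apply: eq_big_seq => y yS.
      by rewrite /splice ifT//; apply/flatten_mapP; exists x.
  by rewrite EFinM (big_morph EFin EFinM (erefl _)).
under eq_integral do rewrite wE.
have mk x : measurable_fun [set: config R V]
    (fun w => (kappa x (c x) w * site_prod f (S x) w)%:E).
  apply/measurable_EFinP; apply: measurable_funM.
    by have := measurableT_comp (measurable_boltzmann_factor x) (pair1_measurable (c x)).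
  exact: measurable_site_prod.
have k0 x w : (0 <= (kappa x (c x) w * site_prod f (S x) w)%:E)%E.
  by rewrite lee_fin mulr_ge0 ?expR_ge0//; apply: prodr_ge0 => y _; exact: ltW.
rewrite ge0_integralZl//; last 3 first.
- rewrite (_ : (fun w => _) = EFin \o (fun w => \prod_(x <- sphere_seq n.+1)
      (kappa x (c x) w * site_prod f (S x) w))).
    apply/measurable_EFinP; apply: measurable_prod => x _.
    by have /measurable_EFinP := mk x.
  by apply/funext => w; rewrite /= (big_morph EFin EFinM (erefl _)).
- by move=> w _; exact: prode_ge0.
- by rewrite lee_fin mulr_ge0 ?expR_ge0//; apply: prodr_ge0 => x _; exact: expR_ge0.
rewrite [X in (_ * X)%E](integral_seq_lebesgue_flatten (F := fun x w =>
  (kappa x (c x) w * site_prod f (S x) w)%:E))//; last 2 first.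
- exact: (uniq_sphere_seq treeL listS n.+2).
- move=> x w w' ww'; congr (_ * _)%:E.
    by congr expR; congr (_ * _); exact: site_energy_local.
  by apply: eq_big_seq => y yS; rewrite ww'.
under [in LHS]eq_bigr do rewrite -/(local_integral S kappa f _ _) f_sol.
rewrite -(big_morph EFin EFinM (erefl _)) -EFinM big_split/=; congr EFin.
by rewrite /tree_weight -/C mulrCA.
Qed.

Definition tree_partition n : R :=
  fine (\int[seq_lebesgue R (ball_seq n.+1)]_c (tree_weight n c)%:E)%E.

Lemma tree_partitionE n : 0 < tree_partition n /\
  (tree_partition n)%:E = (\int[seq_lebesgue R (ball_seq n.+1)]_c (tree_weight n c)%:E)%E.
Proof.
have [l [u [l0 lu]]] := tree_weight_bounded n.
have /andP[lZ Zu] := integral_prob_bnd (seq_lebesgue R (ball_seq n.+1)) (ltW l0)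
  (measurable_tree_weight n) lu.
have E : (tree_partition n)%:E =
    (\int[seq_lebesgue R (ball_seq n.+1)]_c (tree_weight n c)%:E)%E.
  rewrite fineK// fin_numE gt_eqF ?lt_eqF//.
    by rewrite (le_lt_trans Zu) ?ltry.
  by rewrite (lt_le_trans _ lZ) ?ltNyr.
by split=> //; rewrite -lte_fin E (lt_le_trans _ lZ)// lte_fin.
Qed.

Lemma tree_partitionS n :
  tree_partition n.+1 = (\prod_(x <- sphere_seq n.+1) z x) * tree_partition n.
Proof.
apply: EFin_inj; rewrite EFinM (tree_partitionE _).2 (tree_partitionE _).2.
have mw m : measurable_fun [set: config R V] (fun c => (tree_weight m c)%:E).
  by apply/measurable_EFinP; exact: measurable_tree_weight.
have w0 m c : (0 <= (tree_weight m c)%:E)%E by rewrite lee_fin ltW// tree_weight_gt0.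
rewrite -ge0_integralZl//; last by rewrite lee_fin; apply: prodr_ge0 => x _; exact: ltW.
rewrite [LHS](integral_seq_lebesgue_cat (sphere_seq n.+2) (ball_seq n.+1))//.
rewrite (fubini_tonelli (m1 := seq_lebesgue R (sphere_seq n.+2))
  (m2 := seq_lebesgue R (ball_seq n.+1)) _
  (measurableT_comp (mw n.+1) (measurable_splice (sphere_seq n.+2)))
  (fun p => w0 n.+1 _)).
by apply: eq_integral => c _; rewrite /= integral_tree_weight EFinM.
Qed.

(** * The measure on the whole tree and the compatibility of the finite volumes *)

Let tree_blocks n := if n is m.+1 then sphere_seq m.+2 else ball_seq 1.

Let tree_density n c := if n is m.+1 then (tree_partition m)^-1 * tree_weight m c else 1.

Let blocksE n : blocks tree_blocks n.+1 = ball_seq n.+1.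
Proof.
elim: n => [|n IH]; first by rewrite /= !cats0.
by rewrite -[LHS]/(sphere_seq n.+2 ++ blocks tree_blocks n.+1) IH.
Qed.

Let tree_density_ge0 n c : 0 <= tree_density n c.
Proof.
case: n => [|n]; rewrite ?ler01//= mulr_ge0 ?(ltW (tree_weight_gt0 _ _))//.
by rewrite invr_ge0 ltW// (tree_partitionE n).1.
Qed.

Let measurable_tree_density n : measurable_fun [set: config R V] (tree_density n).
Proof.
case: n => [|n]; first exact: measurable_cst.
by apply: measurable_funM => //; exact: measurable_tree_weight.
Qed.

Let tree_density_consistent n c :
  (\int[seq_lebesgue R (tree_blocks n)]_w
    (tree_density n.+1 (splice (tree_blocks n) w c))%:E = (tree_density n c)%:E)%E.
Proof.
have intM m s' : (\int[seq_lebesgue R s']_w ((tree_partition m)^-1 *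
    tree_weight m (splice s' w c))%:E = ((tree_partition m)^-1)%:E *
    \int[seq_lebesgue R s']_w (tree_weight m (splice s' w c))%:E)%E.
  rewrite -ge0_integralZl//.
  - apply/measurable_EFinP; apply: measurableT_comp (measurable_splicel _ _).
    exact: measurable_tree_weight.
  - by move=> w _; rewrite lee_fin ltW// tree_weight_gt0.
  - by rewrite lee_fin invr_ge0 ltW// (tree_partitionE m).1.
have Z_neq0 m : tree_partition m != 0 by rewrite gt_eqF// (tree_partitionE m).1.
(* Block 0 is the ball of radius 1 and density 0 is the constant 1, so consistency at 0 is the
   normalisation of the first measure; afterwards it is the ratio of two partition functions. *)
case: n => [|n] /=; rewrite intM.
  rewrite (_ : (\int[_]_w _)%E = (tree_partition 0)%:E).
    by rewrite -EFinM mulVf.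
  rewrite (tree_partitionE 0).2; apply: eq_integral => w _.
  by congr EFin; apply: tree_weight_local => x xb; rewrite /splice xb.
rewrite integral_tree_weight -EFinM tree_partitionS; congr EFin.
rewrite invfM mulrACA mulVf ?mul1r// gt_eqF//.
by apply: prodr_gt0 => x _.
Qed.

Let tree_measure : exists mu : probability (config R V) R, forall n A,
  measurable A -> local_to (ball_seq n.+1) A ->
  mu A = (\int[seq_lebesgue R (ball_seq n.+1)]_c
    (\1_A c * ((tree_partition n)^-1 * tree_weight n c))%:E)%E.
Proof.
have disj n x : x \in tree_blocks n -> x \notin blocks tree_blocks n.
  by case: n => [//|n]; rewrite blocksE; exact: sphere_ball_disjoint treeL listS n.+1 x.
have cover x : exists n, x \in blocks tree_blocks n.
  exists (gdist L x x0).+1; rewrite blocksE (mem_ball_seq treeL listS).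
  exact: leqnSn.
have [mu muE] := consistent_densities_extension disj cover measurable_tree_density
  tree_density_ge0 (fun=> erefl _) tree_density_consistent.
exists mu => n A mA lA; rewrite (muE n.+1); last by rewrite /cylinder_at blocksE.
by rewrite /block_measure blocksE.
Qed.

Let extend (A : set V) (s : config R A) : config R V :=
  fun x => if insub x is Some a then s a else point.

Let extendK (A : set V) (s : config R A) : config_restriction (extend s) = s.
Proof. by apply/funext => x; rewrite /config_restriction /extend valK. Qed.

Let measurable_extend (A : set V) :
  measurable_fun [set: config R A] (@extend A).
Proof.
apply: measurable_config_fun => x; rewrite /extend; case: insubP => [y _ _|_].
  exact: measurable_config_eval.
exact: measurable_cst.
Qed.

Let gibbs_densityE n c : gibbs_density S xi1 xi2 xi3 J J1 J3 alpha beta h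
  (config_restriction c : config R (ball n.+1)) = (tree_partition n)^-1 * tree_weight n c.
Proof.
rewrite /gibbs_density gibbs_weightE; congr (_^-1 * _).
rewrite /partition_function /Rintegral /tree_partition; congr fine.
rewrite (integral_product_lebesgue (l := ball_seq n.+1)).
- by apply: eq_integral => c' _; rewrite gibbs_weightE.
- exact: (uniq_ball_seq treeL listS n.+1).
- by move=> x; rewrite (mem_ball_seq treeL listS).
- apply/measurable_EFinP.
  rewrite (_ : gibbs_weight S xi1 xi2 xi3 J J1 J3 alpha beta h (n := n.+1) =
      tree_weight n \o @extend (ball n.+1)).
    apply: measurableT_comp; first exact: measurable_tree_weight.
    exact: measurable_extend.
  by apply/funext => s; rewrite /= -gibbs_weightE extendK.
- by move=> s; rewrite lee_fin expR_ge0.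
Qed.

Let measurable_gibbs_density n : measurable_fun [set: config R (ball n.+1)]
  (gibbs_density S xi1 xi2 xi3 J J1 J3 alpha beta h (n := n.+1)).
Proof.
rewrite (_ : gibbs_density S xi1 xi2 xi3 J J1 J3 alpha beta h (n := n.+1) =
    (fun c => (tree_partition n)^-1 * tree_weight n c) \o @extend (ball n.+1)).
  apply: measurableT_comp; last exact: measurable_extend.
  by apply: measurable_funM => //; exact: measurable_tree_weight.
by apply/funext => s; rewrite /= -gibbs_densityE extendK.
Qed.

Let gibbs_density_ge0 n (s : config R (ball n.+1)) :
  0 <= gibbs_density S xi1 xi2 xi3 J J1 J3 alpha beta h s.
Proof. by rewrite -(extendK s) gibbs_densityE (tree_density_ge0 n.+1). Qed.

Lemma tree_weights_compatible :
  compatible L x0 S xi1 xi2 xi3 J J1 J3 alpha beta h.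
Proof.
case=> [//|n] s _.
rewrite (integral_product_lebesgue (l := sphere_seq n.+2)).
- rewrite -[in RHS](extendK s) gibbs_densityE -(tree_density_consistent n.+1 (extend s)).
  apply: eq_integral => w _; rewrite [tree_density _ _]/= -gibbs_densityE.
  congr ((gibbs_density _ _ _ _ _ _ _ _ _ _ _)%:E).
  (* A vertex of the larger ball outside the smaller one has depth exactly [n.+2], so concatenation
     agrees with the splice along that sphere. *)
  apply/funext => x; rewrite /config_concat /config_restriction /splice /extend.
  rewrite -[flatten _]/(sphere_seq n.+2) (mem_sphere_seq treeL listS).
  have xn : (gdist L (val x) x0 <= n.+2)%N by have := set_valP x.
  case: insubP => [y yb _|/negP yb].
    by have yn : (gdist L (val x) x0 <= n.+1)%N := set_mem yb; rewrite ltn_eqF.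
  have xE : gdist L (val x) x0 = n.+2.
    apply/eqP; rewrite eqn_leq xn ltnNge; apply/negP => yn.
    by apply: yb; exact: mem_set.
  rewrite xE eqxx; case: insubP => [y _ ->//|/negP[]].
  exact: mem_set.
- exact: (uniq_sphere_seq treeL listS n.+2).
- by move=> x; rewrite (mem_sphere_seq treeL listS); split=> /eqP.
- apply/measurable_EFinP; apply: (measurableT_comp (@measurable_gibbs_density n.+1)).
  apply: measurable_config_fun => x; rewrite /config_concat.
  case: insubP => [y _ _|_]; first exact: measurable_cst.
  case: insubP => [y _ _|_]; last exact: measurable_cst.
  exact: measurable_config_eval.
- by move=> w; rewrite lee_fin.
Qed.

Lemma tree_weights_measure : exists mu : probability (config R V) R,
  forall n (B : set (config R (ball n))), (1 <= n)%N -> measurable B ->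
  mu (@config_restriction R V (ball n) @^-1` B) =
  finite_volume S xi1 xi2 xi3 J J1 J3 alpha beta h B.
Proof.
have [mu muE] := tree_measure; exists mu => -[//|n] B _ mB.
have mres : measurable_fun [set: config R V] (@config_restriction R V (ball n.+1)).
  by apply: measurable_config_fun => x; exact: measurable_config_eval.
have mpre : measurable (@config_restriction R V (ball n.+1) @^-1` B).
  by rewrite -[X in measurable X]setTI; exact: mres.
rewrite (muE n)//; last first.
  move=> c c' cc'; rewrite /preimage/=; congr B; apply/funext => x.
  rewrite /config_restriction cc'// (mem_ball_seq treeL listS).
  by have := set_valP x.
rewrite /finite_volume [RHS]integral_mkcond.
rewrite (integral_product_lebesgue (l := ball_seq n.+1)).
- apply: eq_integral => c _; rewrite patchE gibbs_densityE indicE.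
  rewrite (_ : (c \in _) = (config_restriction c \in B)); last first.
    by apply/idP/idP; rewrite !inE.
  by case: ifP; rewrite ?mul1r ?mul0r.
- exact: (uniq_ball_seq treeL listS n.+1).
- by move=> x; rewrite (mem_ball_seq treeL listS).
- apply/(measurable_restrictT _ mB); apply/measurable_EFinP.
  by apply: measurable_funS (@measurable_gibbs_density n).
- by move=> s; apply: erestrict_ge0 => s' _; rewrite lee_fin.
Qed.

End gibbs.

Theorem theorem2p5 (R : realType) (k : nat) (V : choiceType) (L : rel V)
    (x0 : V) (S : V -> seq V)
    (k_ge1 : (1 <= k)%N) (treeL : cayley_tree L k)
    (listS : successor_listing L x0 S)
    (xi1 : spin R -> spin R -> spin R -> R) (xi2 xi3 : spin R -> spin R -> R)
    (bxi1 : exists M : R, forall t u v, `|xi1 t u v| <= M)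
    (bxi2 : exists M : R, forall t u, `|xi2 t u| <= M)
    (bxi3 : exists M : R, forall t u, `|xi3 t u| <= M)
    (mxi1 : measurable_fun [set: spin R * spin R * spin R]
              (fun p => xi1 p.1.1 p.1.2 p.2))
    (mxi2 : measurable_fun [set: spin R * spin R] (fun p => xi2 p.1 p.2))
    (mxi3 : measurable_fun [set: spin R * spin R] (fun p => xi3 p.1 p.2))
    (J J1 J3 alpha beta : R)
    (J_neq0 : J != 0) (J1_neq0 : J1 != 0) (J3_neq0 : J3 != 0)
    (alpha_neq0 : alpha != 0) (beta_gt0 : 0 < beta) :
  splitting_gibbs_measures L x0 S xi1 xi2 xi3 J J1 J3 alpha beta !=set0.
Proof.
have [E energyE] := site_energy_bounded (size_successors treeL listS)
  bxi1 bxi2 bxi3 J J1 J3 alpha.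
pose kappa := boltzmann_factor S xi1 xi2 xi3 J J1 J3 alpha beta.
(* [E] bounds the absolute value of the energy at every vertex, so the Boltzmann factors lie between
   [a] and [b]. *)
pose a := expR (- (beta * E)); pose b := expR (beta * E).
have a_gt0 : 0 < a by exact: expR_gt0.
have ab : a <= b.
  rewrite ler_expR ge0_cp// mulr_ge0 ?(ltW beta_gt0)//.
  exact: le_trans (normr_ge0 _) (energyE x0 point point).
have kappa_bnd x t c : a <= kappa x t c <= b.
  rewrite !ler_expR -ler_norml normrM normrN (gtr0_norm beta_gt0).
  by rewrite ler_pM2l.
have S_uniq x : uniq (S x) by have [] := listS x.
have S_level x y : y \in S x -> gdist L y x0 = (gdist L x x0).+1.
  by move=> /(successorP treeL listS)[].
have [f [z [f_meas f_bnd z_gt0 f_sol]]] := local_equations_solvable S_uniq S_level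
  a_gt0 ab (measurable_boltzmann_factor S J J1 J3 alpha beta mxi1 mxi2 mxi3) kappa_bnd.
have [mu muE] := tree_weights_measure treeL listS mxi1 mxi2 mxi3 a_gt0 ab kappa_bnd
  f_meas f_bnd z_gt0 f_sol.
exists mu, (fun t x => ln (f x t)); split => //; last first.
  exact: (tree_weights_compatible treeL listS mxi1 mxi2 mxi3 a_gt0 ab kappa_bnd
    f_meas f_bnd z_gt0 f_sol).
have b_gt0 : 0 < b by exact: expR_gt0.
split=> [|x _]; last exact: measurableT_comp (@measurable_ln R) (f_meas x).
(* Since [a / b] is the inverse of [b / a], the absolute value of [ln (f x t)] is at most
   [ln (b / a)]; adding 1 makes the bound strict. *)
exists (ln (b / a) + 1) => x t _.
have /andP[lf fu] := f_bnd x t.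
have f_gt0 : 0 < f x t by apply: lt_le_trans lf; rewrite divr_gt0.
rewrite ltr_pwDr// ler_norml -lnV ?posrE ?divr_gt0// invf_div.
by rewrite !ler_ln ?posrE ?divr_gt0// lf fu.
Qed.
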